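(* Let $k\ge1$, $n\ge2k+2$ and let $\mathbb{K}$ be a field. If the weight vector $v\in\mathbb{R}^{\binom{[n]}{2}}$ for the variables in $\mathbb{K}[x_{i,j}:\{i,j\}\in\binom{[n]}{2}]$ lies in $\mathrm{Grob}_k(n)$ (in particular, if it is fp-positive) and is generic, then the initial ideal $\mathrm{in}_v(I_k(n))$ equals the Stanley–Reisner ideal of the extended $k$-associahedron $\mathcal{A}ss_k(n)$; that is, it is the radical monomial ideal whose square-free standard monomials form, as a simplicial complex, $\mathcal{A}ss_k(n)$.
   Context: Edges $\{i,j\},\{i',j'\}\in\binom{[n]}{2}$ with $i<j$, $i'<j'$ cross if $i<i'<j<j'$ or $i'<i<j'<j$. A $(k+1)$-crossing is a set of $k+1$ mutually crossing edges. $\mathcal{A}ss_k(n)$ is the simplicial complex on vertex set $\binom{[n]}{2}$ whose faces are the subsets containing no $(k+1)$-crossing. For $U\subset[n]$ with $|U|=2k+2$, the Pfaffian of degree $k+1$ of $U$ is $\sum_E(-1)^{\mathrm{cr}(E)}\prod_{\{i,j\}\in E}x_{i,j}$ over perfect matchings $E$ of $U$, where $\mathrm{cr}(E)$ is the number of crossing pairs in $E$. $I_k(n)$ is the ideal generated by all these Pfaffians. $\mathrm{Grob}_k(n)$ is the set of $v$ such that for every such $U$ the maximum of $\sum_{\{i,j\}\in E}v_{i,j}$ over perfect matchings $E$ of $U$ is attained at (possibly among others) the unique $(k+1)$-crossing perfect matching of $U$. A vector $v$ is fp-positive if $v_{a,b}+v_{a',b'}\ge\max\{v_{a,a'}+v_{b,b'},v_{a,b'}+v_{a',b}\}$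 for all $1\le a<a'<b<b'\le n$. $\mathrm{in}_v(f)$ is the sum of the terms of $f$ of maximum $v$-weight; $\mathrm{in}_v(I)$ is the ideal generated by the $\mathrm{in}_v(f)$, $f\in I$. A standard monomial is a monomial not in the initial ideal. ''Generic'' means outside some finite union of proper linear hyperplanes. *)

(* Defs.v *)
From mathcomp Require Import all_boot all_order all_algebra.
From mathcomp Require Import reals mpoly.

Set Implicit Arguments.
Unset Strict Implicit.
Unset Printing Implicit Defensive.

Import Order.TTheory GRing.Theory Num.Theory.

Local Open Scope ring_scope.

(* The vertex set [n] = {1, ..., n} is modelled by 'I_n, and the edge {i, j}
   with i < j by the ordered pair (i, j). *)
Definition edge (n : nat) := {e : 'I_n * 'I_n | (e.1 < e.2)%N}.

Definition mkedge n (i j : 'I_n) (ltij : (i < j)%N) : edge n :=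
  exist (fun e : 'I_n * 'I_n => (e.1 < e.2)%N) (i, j) ltij.

Section Combinatorics.
Context {n : nat}.
Implicit Types (e f : edge n) (E C F : {set edge n}) (U : {set 'I_n}).

Definition ends e : {set 'I_n} := [set (val e).1; (val e).2].

Definition cross e f : bool :=
  let: (i, j) := val e in let: (i', j') := val f in
  [&& i < i', i' < j & j < j']%N || [&& i' < i, i < j' & j' < j]%N.

Definition is_crossing (m : nat) C : bool :=
  (#|C| == m) && [forall e in C, forall f in C, (e != f) ==> cross e f].

Definition Ass (k : nat) : {set {set edge n}} :=
  [set F : {set edge n} |
     ~~ [exists C : {set edge n}, (C \subset F) && is_crossing k.+1 C]].

Definition perfect_matching U E : bool := partition [set ends e | e in E] U.

Definition cr E : nat :=
  #|[set C : {set edge n} | (C \subset E) && is_crossing 2 C]|.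

End Combinatorics.

Section Weights.
Context {R : realType} {n : nat}.
Implicit Types (v h : {ffun edge n -> R}).

Definition set_weight v (E : {set edge n}) : R := \sum_(e in E) v e.

Definition Grob (k : nat) v : Prop :=
  forall U : {set 'I_n}, #|U| = (2 * k + 2)%N ->
  exists C : {set edge n},
    [/\ perfect_matching U C, is_crossing k.+1 C &
        forall E : {set edge n}, perfect_matching U E ->
          set_weight v E <= set_weight v C].

Definition fp_positive v : Prop :=
  forall (a a' b b' : 'I_n)
         (ltaa' : (a < a')%N) (lta'b : (a' < b)%N) (ltbb' : (b < b')%N),
  Num.max (v (mkedge ltaa') + v (mkedge ltbb'))
          (v (mkedge (ltn_trans (ltn_trans ltaa' lta'b) ltbb'))
             + v (mkedge lta'b))
    <= v (mkedge (ltn_trans ltaa' lta'b)) + v (mkedge (ltn_trans lta'b ltbb')).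

(* A proper linear hyperplane is the kernel of a nonzero linear form, here
   given by its coefficient vector h. *)
Definition for_generic (P : {ffun edge n -> R} -> Prop) : Prop :=
  exists2 hs : seq {ffun edge n -> R},
    0 \notin hs &
    forall v, (forall h, h \in hs -> \sum_(e : edge n) h e * v e != 0) -> P v.

End Weights.

Section Ideals.
Context {K : fieldType} {N : nat}.
Implicit Types (f g : {mpoly K[N]}) (G I J : {mpoly K[N]} -> Prop).

(* Ideals are represented by their membership predicates. *)
Definition ideal_gen G f : Prop :=
  exists2 s : seq ({mpoly K[N]} * {mpoly K[N]}),
    (forall p, p \in s -> G p.2) & f = \sum_(p <- s) p.1 * p.2.

Definition is_radical J : Prop := forall f (m : nat), J (f ^+ m) -> J f.

Definition is_monomial_ideal J : Prop :=
  exists M : 'X_{1..N} -> Prop,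
    forall f, J f <-> ideal_gen (fun g => exists2 m, M m & g = 'X_[m]) f.

Definition standard_monomial J (m : 'X_{1..N}) : Prop := ~ J 'X_[m].

End Ideals.

(* The polynomial ring K[x_{i,j}]: the variable attached to the edge e is the
   one of index enum_rank e. *)
Notation edge_poly K n := {mpoly K[#|{: edge n}|]}.
Notation edge_monom n := 'X_{1..#|{: edge n}|}.

Section InitialIdeals.
Context {R : realType} {K : fieldType} {n : nat}.
Implicit Types (v : {ffun edge n -> R}) (f g : edge_poly K n).

Definition monom_weight v (m : edge_monom n) : R :=
  \sum_(e : edge n) v e *+ m (enum_rank e).

Definition initial_form v f : edge_poly K n :=
  \sum_(m <- msupp f |
          all (fun m' => monom_weight v m' <= monom_weight v m) (msupp f))
    f@_m *: 'X_[m].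

Definition initial_ideal v (I : edge_poly K n -> Prop) : edge_poly K n -> Prop :=
  ideal_gen (fun g => exists2 f, I f & g = initial_form v f).

End InitialIdeals.

Definition sqfree_monom n (F : {set edge n}) : edge_monom n :=
  (\sum_(e in F) U_(enum_rank e))%MM.

Section EdgeIdeals.
Context (K : fieldType) {n : nat}.

Definition pfaffian (U : {set 'I_n}) : edge_poly K n :=
  \sum_(E : {set edge n} | perfect_matching U E)
    (-1) ^+ cr E * \prod_(e in E) 'X_(enum_rank e).

Definition pfaffian_ideal (k : nat) : edge_poly K n -> Prop :=
  ideal_gen (fun f => exists2 U : {set 'I_n},
                        #|U| = (2 * k + 2)%N & f = pfaffian U).

Definition stanley_reisner (D : {set {set edge n}}) : edge_poly K n -> Prop :=
  ideal_gen (fun f => exists2 F : {set edge n},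
                        F \notin D & f = 'X_[sqfree_monom F]).

End EdgeIdeals.

(* Main.v *)
Require Import Defs.
From mathcomp Require Import all_boot all_order all_algebra.
From mathcomp Require Import reals mpoly.
From mathcomp Require Import fraction zify ring.

(**
For generic [v] in [Grob k], the initial form of the Pfaffian of [U] is, up to
sign, the monomial of the crossing matching of [U]; so the initial ideal
contains the Stanley-Reisner ideal, and reduction modulo the Pfaffians shows
that equality holds as soon as the monomials whose support has no
[(k+1)]-crossing are linearly independent modulo the Pfaffian ideal.

Independence does not depend on [v].  It is tested on skew-symmetric matrices
of rank at most [2 k] over [K[t]], on which the Pfaffians vanish.  Rescaling
rows and columns by powers of [t], the upper triangle of such a matrix can be
given the leading behaviour of the upper triangle of any matrix of rank [k].
If [m] is the leading monomial of a combination of standard monomials for a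
suitable weight, which satisfies the Monge inequalities
[v i j' + v i' j <= v i j + v i' j'] for [i < i' < j < j'], it is enough to
find a matrix [X] of rank [k] such that [deg X_ij <= v i j] for [i < j], with
equality when [x_ij] divides [m].  It is constructed by induction on [k] as
[X_ij = q_j (p_i + sum_(i < m < j) X'_im)] where [q_j] and [p_i] are powers of
[t] and [X'] has rank [k - 1]: in the row [i], the degrees of [X_ij / q_j] are
the running maxima of those of [p_i] and [X'_im], so that [X'] only has to
produce the jumps, and these form a set without [k]-crossing.
*)

Set Implicit Arguments.
Unset Strict Implicit.
Unset Printing Implicit Defensive.

Import Order.TTheory GRing.Theory Num.Theory.

Local Open Scope ring_scope.

(** * Tropical factorization *)

Section Tropical.

Definition monge (n : nat) (v : nat -> nat -> int) : Prop :=
  forall i i' j j', (i < i')%N -> (i' < j)%N -> (j < j')%N -> (j' < n)%N ->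
    v i j' + v i' j <= v i j + v i' j'.

(* No crossing of size [k + 1]: [a] and [b] list the ends of a chain [0..k]. *)
Definition crossing_free (k : nat) (F : rel nat) : Prop :=
  forall a b : nat -> nat,
    (forall t, (t <= k)%N -> F (a t) (b t)) ->
    (forall t, (t < k)%N -> (a t < a t.+1)%N && (b t < b t.+1)%N) ->
    (b 0 <= a k)%N.

(* The value is [n] when the column [j] of [F] is empty. *)
Definition top_row (n : nat) (F : rel nat) (j : nat) : nat :=
  find (F^~ j) (iota 0 n).

Definition next_col (n : nat) (F : rel nat) (i m : nat) : nat :=
  m.+1 + find (F i) (iota m.+1 (n - m.+1)).

(** The corner between the top entry of column [m] and the next entry of row [i]: before that entry,
    [m] is the last column whose top lies strictly above row [i]. These are the jumps of the running
    maximum in row [i]. *)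
Definition derived (n : nat) (F : rel nat) : rel nat := fun i m =>
  [&& (i < m)%N, (top_row n F m < i)%N, (next_col n F i m < n)%N &
      all (fun m' => i <= top_row n F m')%N (iota m.+1 (next_col n F i m - m.+1))].

Variables (n : nat) (F : rel nat) (v : nat -> nat -> int).
Hypothesis F_lt : forall i j, F i j -> (i < j < n)%N.

Lemma top_row_le i j : F i j -> (top_row n F j <= i)%N.
Proof.
move=> Fij; have /andP[ij jn] := F_lt Fij.
rewrite leqNgt; apply/negP => lt_i.
have := before_find 0%N lt_i; rewrite nth_iota ?add0n ?Fij //; lia.
Qed.

Lemma top_row_mem j : (top_row n F j < n)%N -> F (top_row n F j) j.
Proof.
move=> lt_n; have h : has (F^~ j) (iota 0 n) by rewrite has_find size_iota.
by have := nth_find 0%N h; rewrite nth_iota.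
Qed.

Lemma next_col_gt i m : (m < next_col n F i m)%N.
Proof. by rewrite /next_col addSn ltnS leq_addr. Qed.

Lemma next_col_mem i m : (next_col n F i m < n)%N -> F i (next_col n F i m).
Proof.
rewrite /next_col => lt_n.
have h : has (F i) (iota m.+1 (n - m.+1)) by rewrite has_find size_iota; lia.
have := nth_find 0%N h; rewrite nth_iota //; lia.
Qed.

Lemma next_col_le i j m : F i j -> (m < j)%N -> (next_col n F i m <= j)%N.
Proof.
move=> Fij mj; have /andP[ij jn] := F_lt Fij.
rewrite leqNgt; apply/negP => lt_j; rewrite /next_col in lt_j.
have lt_f : (j - m.+1 < find (F i) (iota m.+1 (n - m.+1)))%N by lia.
have := before_find 0%N lt_f; rewrite nth_iota; last by lia.
by rewrite subnKC ?Fij.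
Qed.

Lemma derivedP i m : derived n F i m ->
  [/\ (i < m)%N, (top_row n F m < i)%N, F (top_row n F m) m, F i (next_col n F i m) &
      forall m', (m < m')%N -> (m' < next_col n F i m)%N -> (i <= top_row n F m')%N].
Proof.
case/and4P => im tm nn /allP al.
have Fn := next_col_mem nn; have /andP[_ _] := F_lt Fn.
have Ft : F (top_row n F m) m.
  by apply: top_row_mem; have := next_col_gt i m; lia.
split=> // m' mm' m'n; apply: al; rewrite mem_iota; have := next_col_gt i m; lia.
Qed.

Lemma derived_lt i m : derived n F i m -> (i < m < n.-1)%N.
Proof.
case/derivedP => im _ _ Fn _; have /andP[_ h] := F_lt Fn.
have := next_col_gt i m; lia.
Qed.

Lemma derived_mem i j m : F i j -> (i < m < j)%N -> (top_row n F m < i)%N ->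
  (forall m', (m < m' < j)%N -> (i <= top_row n F m')%N) -> derived n F i m.
Proof.
move=> Fij /andP[im mj] tm hm; have /andP[_ jn] := F_lt Fij.
have nj := next_col_le Fij mj.
apply/and4P; split=> //; first by lia.
by apply/allP => m'; rewrite mem_iota => h; apply: hm; lia.
Qed.

(* As for Viennot's shadow lines, a chain of corners of the derived relation
   yields a chain of the original one with one more element. *)
Lemma derived_crossing_free k :
  crossing_free k.+1 F -> crossing_free k (derived n F).
Proof.
move=> cf a b hF mono; rewrite leqNgt; apply/negP => lt_ab.
pose tp t := top_row n F (b t); pose nx t := next_col n F (a t) (b t).
(* The longer chain starts with the top entry of column [b 0] and ends with the row entry of corner
   [k]. In between, element [t.+1] is the row entry of corner [t] if the top of column [b t.+1] lies
   above row [a t], and otherwise that top. *)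
pose A t := if t is t'.+1 then
    if (t' == k) || (tp t'.+1 < a t')%N then a t' else tp t'.+1 else tp 0%N.
pose C t := if t is t'.+1 then
    if (t' == k) || (tp t'.+1 < a t')%N then nx t' else b t'.+1 else b 0%N.
have hD t (tk : (t <= k)%N) := derivedP (hF t tk).
suff : (C 0%N <= A k.+1)%N by rewrite /C /A eqxx /=; lia.
apply: cf => [[|t] tk|[|t] tk].
- by have [] := hD 0%N isT.
- rewrite /A /C; case: ifP => [_|/negbT].
    by have [] := hD t tk.
  rewrite negb_or => /andP[tk' _].
  by have [] := hD t.+1 _ => //; lia.
- have [h1 h2 h3 h4 h5] := hD 0%N isT; rewrite /A /C.
  have bn : (b 0 < nx 0)%N by exact: next_col_gt.
  case: ifP => [_|/negbT]; first by apply/andP; split.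
  rewrite negb_or -leqNgt => /andP[k0 le_a].
  have /mono : (0 < k)%N by lia.
  rewrite /tp in le_a *; lia.
- have tk' : (t < k)%N by [].
  have [h1 h2 h3 h4 h5] := hD t.+1 tk'.
  have [g1 g2 g3 g4 g5] := hD t (ltnW tk').
  have /andP[aa bb] := mono t tk'.
  have bn : (b t.+1 < nx t.+1)%N by exact: next_col_gt.
  (* No column strictly between [b t] and [nx t] has its top above row [a t]. *)
  have nb : (tp t.+1 < a t)%N -> (nx t <= b t.+1)%N.
    move=> lt; rewrite leqNgt; apply/negP => h.
    by have := g5 _ bb h; rewrite leqNgt lt.
  rewrite /A /C (ltn_eqF tk') /=.
  have [lt_t|ge_t] := ltnP (tp t.+1) (a t).
    have {}nb := nb lt_t.
    case: ifP => [_|/negbT]; first by rewrite aa /=; lia.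
    rewrite negb_or -leqNgt => /andP[tk2 le_a].
    have /mono : (t.+1 < k)%N by lia.
    lia.
  case: ifP => [_|/negbT]; first by rewrite /tp in ge_t *; lia.
  rewrite negb_or -leqNgt => /andP[tk2 le_a].
  have /mono : (t.+1 < k)%N by lia.
  rewrite /tp in le_a *; lia.
Qed.

(** The bound [j.-1] keeps [(low_row j, j)] strictly above the diagonal, where the Monge
    inequalities apply, also when the column is empty. *)
Definition low_row (j : nat) : nat := minn (top_row n F j) j.-1.

Lemma low_row_lt j : (0 < j)%N -> (low_row j < j)%N.
Proof. rewrite /low_row; lia. Qed.

(** Going from the last column backwards, [q j] is chosen so that the normalised entry of column [j]
    in row [low_row j] equals the minimum of those to its right. By the Monge inequalities, in lower
    rows it is then at most all later ones, and in higher rows at least one of them. *)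
Lemma exists_potential : exists q : nat -> int,
  forall j, (0 < j < n)%N ->
    (forall j', (j < j' < n)%N ->
       v (low_row j) j - q j <= v (low_row j) j' - q j') /\
    ((j.+1 < n)%N -> exists2 j', (j < j' < n)%N &
       v (low_row j) j - q j = v (low_row j) j' - q j').
Proof.
suff: forall d, exists q : nat -> int,
  forall j, (n - d <= j)%N -> (0 < j < n)%N ->
    (forall j', (j < j' < n)%N ->
       v (low_row j) j - q j <= v (low_row j) j' - q j') /\
    ((j.+1 < n)%N -> exists2 j', (j < j' < n)%N &
       v (low_row j) j - q j = v (low_row j) j' - q j').
  by move=> /(_ n)[q hq]; exists q => j; apply: hq; rewrite subnn.
elim=> [|d [q hq]]; first by exists (fun=> 0) => j; rewrite subn0; lia.
set j0 := (n - d.+1)%N.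
have [dn|dn] := leqP n d.
  by exists q => j h; apply: hq; lia.
have [m hm] : exists m : int,
    (forall j', (j0 < j' < n)%N -> v (low_row j0) j0 - m <= v (low_row j0) j' - q j')
    /\ ((j0.+1 < n)%N -> exists2 j', (j0 < j' < n)%N &
       v (low_row j0) j0 - m = v (low_row j0) j' - q j').
  pose f j' : int := v (low_row j0) j0 - (v (low_row j0) j' - q j').
  have [n0|n0] := leqP n j0.+1.
    by exists 0; split=> [j'|]; lia.
  have hi : (j0.+1 < n)%N by [].
  pose s := [arg max_(i > Ordinal hi | (j0 < i)%N) f i]%O.
  exists (f s); rewrite /s; case: Order.TotalTheory.arg_maxP => [|i ij0 hi'] //=.
  split=> [j' /andP[h1 h2]|_].
    by have := hi' (Ordinal h2) h1; rewrite /f /=; lia.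
  by exists i; [rewrite ij0 ltn_ord|rewrite /f; lia].
exists (fun j => if j == j0 then m else q j) => j h1 h2.
have [->|jj0] := eqVneq j j0.
  case: hm => hm1 hm2; split=> [j' h|h].
    by rewrite gtn_eqF ?hm1 //; lia.
  by have [j' h' e] := hm2 h; exists j' => //; rewrite gtn_eqF //; lia.
have [|hq1 hq2] := hq j _ h2; first by lia.
split=> [j' h|h]; first by rewrite gtn_eqF ?hq1 //; lia.
by have [j' h' e] := hq2 h; exists j' => //; rewrite gtn_eqF //; lia.
Qed.

Hypothesis v_monge : monge n v.

Lemma monge_le i i' j j' : (i <= i')%N -> (i' < j)%N -> (j < j')%N ->
  (j' < n)%N -> v i j' + v i' j <= v i j + v i' j'.
Proof.
move=> ii' i'j jj' j'n; have [->|ne] := eqVneq i i'; first by rewrite addrC.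
by apply: v_monge => //; rewrite ltn_neqAle ne.
Qed.

(** For [m < n.-1] the default value [f n.-1] is one of the values compared. *)
Definition suffix_min (f : nat -> int) (m : nat) : int :=
  \big[Num.min/f n.-1]_(m.+1 <= j < n) f j.

Lemma suffix_min_le f m j : (m < j < n)%N -> suffix_min f m <= f j.
Proof.
move=> /andP[mj jn]; rewrite /suffix_min.
have : j \in index_iota m.+1 n by rewrite mem_index_iota mj.
elim: (index_iota _ _) => // a s IH; rewrite inE big_cons ge_min.
by case: eqVneq => [->|_ /= /IH ->]; rewrite ?lexx ?orbT.
Qed.

Lemma suffix_min_ex f m : (m < n.-1)%N ->
  exists2 j, (m < j < n)%N & suffix_min f m = f j.
Proof.
move=> mn; rewrite /suffix_min.
have : all (fun j => m < j < n)%N (index_iota m.+1 n).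
  by apply/allP => j; rewrite mem_index_iota.
elim: (index_iota _ _) => [_|a s IH /= /andP[ha /IH[j hj e]]].
  by exists n.-1; rewrite ?big_nil //; lia.
rewrite big_cons e; case: (leP (f a) (f j)) => _.
  by exists a.
by exists j.
Qed.

(** Let [a] and [b] attain the two minima on the right-hand side. If [a] lies beyond [m'], both
    remain admissible on the left; otherwise [a <= m' < b], and the Monge inequality for the columns
    [a] and [b] lets them exchange rows. *)
Lemma monge_suffix_min q :
  monge n.-1 (fun i m => suffix_min (fun j => v i j - q j) m).
Proof.
move=> i i' m m' ii' i'm mm' m'n.
have [|a /andP[ma an] ->] := @suffix_min_ex (fun j => v i j - q j) m; first lia.
have [b /andP[mb bn] ->] := suffix_min_ex (fun j => v i' j - q j) m'n.
have hm := @suffix_min_le (fun j => v i j - q j) m'.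
have hm' := @suffix_min_le (fun j => v i' j - q j) m.
have [am|am] := ltnP m' a.
  by apply: lerD; [apply: hm; rewrite am|apply: hm'; lia].
have h1 : (m' < b < n)%N by rewrite mb.
have h2 : (m < a < n)%N by rewrite ma.
have := hm _ h1; have := hm' _ h2.
have : v i b + v i' a <= v i a + v i' b by apply: v_monge; lia.
lia.
Qed.

(** With [v' i m] the minimum of the normalised row [i] to the right of [m], and [p i] the same
    minimum to the right of [i], the bounds are immediate. At an entry of [F] the minimum is
    attained for [m] the last earlier column whose top is above row [i], or for [p i] if there is
    none. *)
Lemma tropical_step : exists (p q : nat -> int) (v' : nat -> nat -> int),
  [/\ monge n.-1 v',
      forall i j, (i < j < n)%N -> p i <= v i j - q j,
      forall i m j, (i < m)%N -> (m < j < n)%N -> v' i m <= v i j - q j &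
      forall i j, F i j -> v i j - q j <= p i \/
        exists2 m, (i < m < j)%N & derived n F i m /\ v i j - q j <= v' i m].
Proof.
have [q hq] := exists_potential.
exists (fun i => suffix_min (fun j => v i j - q j) i), q.
exists (fun i m => suffix_min (fun j => v i j - q j) m).
(* Row [i] is at or below [low_row j], so the minimality of column [j] carries over from that
   row. *)
have suf i j j' : F i j -> (j < j' < n)%N -> v i j - q j <= v i j' - q j'.
  move=> Fij h; have /andP[ij jn] := F_lt Fij.
  have [|hq1 _] := hq j; first lia.
  have := hq1 j' h; have := @monge_le (low_row j) i j j'.
  have := top_row_le Fij; rewrite /low_row; lia.
(* Here row [i] is at or above [low_row j'], so the tie at [j'] gives a later column whose value in
   row [i] is no larger; iteration reaches [j] or passes it, where [suf] concludes. *)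
have pre i j j' : F i j -> (i < j' < j)%N ->
    (forall m, (j' <= m < j)%N -> (i <= top_row n F m)%N) ->
    v i j - q j <= v i j' - q j'.
  move=> Fij; have /andP[_ jn] := F_lt Fij.
  have [d] := ubnP (j - j')%N; elim: d j' => // d IH j' ltd /andP[ij' j'j] ht.
  have [|_ hq2] := hq j'; first lia.
  have [|j'' /andP[h1 h2] e] := hq2; first lia.
  have mg : v i j'' + v (low_row j') j' <= v i j' + v (low_row j') j''.
    apply: monge_le => //; last by apply: low_row_lt; lia.
    by rewrite /low_row leq_min ht ?leqnn //; lia.
  have [jj''|jj''|jj''] := ltngtP j j''; last by subst j''; lia.
    by have := suf i j j'' Fij; rewrite jj'' h2 => /(_ isT); lia.
  have : v i j - q j <= v i j'' - q j''.
    by apply: IH => [||m hm]; [lia|lia|apply: ht; lia].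
  lia.
split=> [|i j h|i m j im h|i j Fij].
- exact: monge_suffix_min.
- exact: (@suffix_min_le (fun j => v i j - q j)).
- exact: (@suffix_min_le (fun j => v i j - q j)).
have /andP[ij jn] := F_lt Fij.
pose P m := (i < m < j)%N && (top_row n F m < i)%N.
have [/hasP[m0 _ m0P]|/hasPn noP] := boolP (has P (iota 0 j)).
  have exP : exists m, P m by exists m0.
  have ubP m : P m -> (m <= j)%N by case/andP => /andP[_ /ltnW].
  case: (ex_maxnP exP ubP) => m /andP[imj tm] maxm.
  have htop m' : (m < m' < j)%N -> (i <= top_row n F m')%N.
    move=> h; rewrite leqNgt; apply/negP => lt; have := maxm m'; rewrite /P; lia.
  right; exists m => //; split; first exact: derived_mem Fij imj tm htop.
  have [|j' h ->] := @suffix_min_ex (fun j => v i j - q j) m; first lia.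
  have [jj'|jj'|<- //] := ltngtP j j'; first by apply: suf => //; lia.
  apply: pre => // [|m' hm']; first lia.
  by apply: htop; lia.
left; have [|j' h ->] := @suffix_min_ex (fun j => v i j - q j) i; first lia.
have [jj'|jj'|<- //] := ltngtP j j'; first by apply: suf => //; lia.
apply: pre => // [|m' hm']; first lia.
rewrite leqNgt; apply/negP => lt.
have := noP m'; rewrite mem_iota /P; lia.
Qed.

End Tropical.

(** * Realization of the weights by polynomial matrices of rank at most [k] *)

Section Realization.

Variable K : fieldType.

Definition monic_deg (p : {poly K}) (d : nat) : Prop :=
  p \is monic /\ size p = d.+1.

Lemma monic_degXn d : monic_deg 'X^d d.
Proof. by split; [exact: monicXn | rewrite size_polyXn]. Qed.

Lemma monic_degM p q d e :
  monic_deg p d -> monic_deg q e -> monic_deg (p * q) (d + e).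
Proof.
case=> mp sp [mq sq]; split; first by rewrite monicMl.
by rewrite size_mul ?monic_neq0 // sp sq addnS.
Qed.

Lemma monic_degDl (p q : {poly K}) d :
  monic_deg p d -> (size q < d.+1)%N -> monic_deg (p + q) d.
Proof.
case=> mp sp lt; split; last by rewrite size_polyDl ?sp.
by rewrite monicE lead_coefDl ?sp // -monicE.
Qed.

(** Weights are encoded in degrees as [c + B u + e]: [B] is the scale, the shift [c] makes the
    exponents nonnegative, and [e <= E] is a perturbation that breaks ties. *)
Definition fits (k n : nat) (F : rel nat) (v : nat -> nat -> int)
    (E B c : nat) (P Q : nat -> nat -> {poly K}) : Prop :=
  forall i j, (i < j < n)%N ->
    let X := \sum_(l < k) P i l * Q j l in
    (~~ F i j /\ X = 0) \/
    exists (u : int) (e d : nat),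
      [/\ monic_deg X d, d%:Z = c%:Z + B%:Z * u + e%:Z, (e <= E)%N,
          u <= v i j & F i j -> v i j <= u].

(** The order of quantifiers serves the induction: the same [B] is used throughout, whereas the
    shift of the smaller matrix depends on [B]. *)
Lemma realization (k n : nat) (F : rel nat) (v : nat -> nat -> int) :
    (forall i j, F i j -> (i < j < n)%N) -> monge n v -> crossing_free k F ->
  exists E, forall B, (E < B)%N -> exists c0, forall c, (c0 <= c)%N ->
    exists P Q, fits k n F v E B c P Q.
Proof.
elim: k n F v => [|k IH] n F v F_lt v_monge cf.
  exists 0%N => B _; exists 0%N => c _; exists (fun _ _ => 0), (fun _ _ => 0).
  move=> i j ij; left; rewrite big_ord0; split=> //.
  apply/negP => Fij; have /andP[lt_ij _] := F_lt _ _ Fij.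
  suff : (j <= i)%N by rewrite leqNgt lt_ij.
  by apply: (cf (fun=> i) (fun=> j)) => // t; rewrite ltn0.
have [p [q [v' [v'_monge hp hv' hF]]]] := tropical_step F_lt v_monge.
have [E' hE'] := IH n.-1 _ _ (@derived_lt n F F_lt) v'_monge
                   (derived_crossing_free F_lt cf).
(* The unit [e0] exceeds all perturbations of the smaller matrix, so the factors ['X^(m.+1 * e0)]
   give successive summands strictly increasing perturbations. *)
pose e0 := E'.+1; exists (n.+1 * e0)%N => B ltB.
have [|c0 hc0] := hE' B; first by rewrite /e0 in ltB *; nia.
pose M := (\sum_(i < n) (`|p i| + `|q i|))%N.
have hM i : (i < n)%N -> (`|p i| + `|q i| <= M)%N.
  by move=> lt; rewrite /M (bigD1 (Ordinal lt)) //= leq_addr.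
(* The shift [c] splits into [c'], which makes the exponents [al i] nonnegative and is the shift of
   the smaller matrix, and [a], which does the same for [be j]. *)
pose c' := (c0 + B * M)%N.
exists (c' + B * M)%N => c lec; pose a := (c - c')%N.
have [P [Q hPQ]] := hc0 c' (leq_addr _ _).
pose al i := absz (c'%:Z + B%:Z * p i).
pose be j := absz (a%:Z + B%:Z * q j).
have alE i : (i < n)%N -> (al i)%:Z = c'%:Z + B%:Z * p i.
  by move=> /hM h; rewrite /al /c'; nia.
have beE j : (j < n)%N -> (be j)%:Z = a%:Z + B%:Z * q j.
  by move=> /hM h; rewrite /be /a; nia.
pose X i m := \sum_(l < k) P i l * Q m l.
(* The sum over [i < m < j] is a difference of the partial sums [C j l] and [C i.+1 l]. The second
   depends on the row only and is absorbed into [P1 i 0], so one additional column suffices. *)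
pose C j l := \sum_(m < j) 'X^(m.+1 * e0) * Q m l.
pose S i j := 'X^(al i) + \sum_(i.+1 <= m < j) 'X^(m.+1 * e0) * X i m.
pose P1 i l := if l is l'.+1 then P i l' else
  'X^(al i) - \sum_(l < k) P i l * C i.+1 l.
pose Q1 j l := 'X^(be j) * (if l is l'.+1 then C j l' else 1).
have SE i j : (i < j)%N -> \sum_(l < k.+1) P1 i l * Q1 j l = 'X^(be j) * S i j.
  move=> ij.
  transitivity ('X^(be j) * (P1 i 0%N + \sum_(l < k) P i l * C j l)).
    rewrite big_ord_recl mulrDr mulr_sumr; congr (_ + _).
      by rewrite /Q1 mulr1 mulrC.
    by apply: eq_bigr => l _; rewrite /P1 /Q1 /= mulrCA.
  congr (_ * _); rewrite /P1 /S -addrA.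
  congr (_ + _); rewrite -sumrN -big_split /=.
  under [RHS]eq_bigr => m _ do rewrite /X mulr_sumr.
  rewrite exchange_big /=; apply: eq_bigr => l _; rewrite addrC -mulrBr.
  rewrite /C -(big_mkord xpredT (fun m => 'X^(m.+1 * e0) * Q m l)).
  rewrite -[in X in _ * (_ - X)](big_mkord xpredT (fun m => 'X^(m.+1 * e0) * Q m l)).
  rewrite (big_cat_nat (leq0n i.+1) ij) /= addrAC subrr add0r mulr_sumr.
  by apply: eq_bigr => m _; rewrite mulrCA.
exists P1, Q1 => i j /andP[ij jn] /=; rewrite (SE _ _ ij).
(* Running maximum in row [i], by induction on [j]: [w] is the weight of the leading term, [e] its
   perturbation, smaller than that of the next summand. For [w <= u] the new summand wins, a tie
   being decided by the perturbation; for [u < w] one unit of [B] outweighs the perturbation. *)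
have [w [e [d [hS dE le_e [hw1 hw2] hw3]]]] : exists (w : int) (e d : nat),
    [/\ monic_deg (S i j) d, d%:Z = c'%:Z + B%:Z * w + e%:Z,
        (e < j.+1 * e0)%N,
        (p i <= w) /\
        forall m, (i < m < j)%N -> derived n F i m -> v' i m <= w
      & forall j', (j <= j' < n)%N -> w <= v i j' - q j'].
  elim: j ij jn => // j IHj; rewrite ltnS leq_eqVlt => /orP[/eqP<-|ij] jn.
    exists (p i), 0%N, (al i); rewrite /S big_geq // addr0; split=> //.
    - exact: monic_degXn.
    - by rewrite alE ?addr0 //; lia.
    - by split=> // m; lia.
    by move=> j' h; apply: hp; lia.
  have [w [e [d [hS dE le_e [hw1 hw2] hw3]]]] := IHj ij (ltnW jn).
  have SSE : S i j.+1 = S i j + 'X^(j.+1 * e0) * X i j.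
    by rewrite /S big_nat_recr //= addrA.
  have ijn : (i < j < n.-1)%N by lia.
  have [[nF X0]|[u [e' [d' [hX d'E le_e' hu hFu]]]]] := hPQ i j ijn.
    exists w, e, d; rewrite SSE /X X0 mulr0 addr0; split=> //.
    - by rewrite mulSn; lia.
    - split=> // m /andP[im]; rewrite ltnS leq_eqVlt => /orP[/eqP->|mj] dm.
        by rewrite dm in nF.
      by apply: hw2 => //; rewrite im.
    by move=> j' h; apply: hw3; lia.
  have hX' := monic_degM (monic_degXn (j.+1 * e0)) hX.
  set e2 := (j.+1 * e0 + e')%N.
  have le_e2 : (e2 < j.+2 * e0)%N by rewrite /e2 [(j.+2 * _)%N]mulSn /e0; lia.
  have lt_e2B : (e2 < B)%N by nia.
  have lt_ee : (e < e2)%N by rewrite /e2; lia.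
  have d2E : (j.+1 * e0 + d')%N%:Z = c'%:Z + B%:Z * u + e2%:Z.
    by rewrite PoszD d'E /e2 PoszD; lia.
  case: (lerP w u) => [wu|uw].
    exists u, e2, (j.+1 * e0 + d')%N; split=> //.
    - rewrite SSE addrC; apply: monic_degDl => //.
      by case: hS => _ ->; nia.
    - split=> [|m /andP[im]]; first exact: le_trans wu.
      rewrite ltnS leq_eqVlt => /orP[/eqP->|mj] dm; first exact: hFu.
      by apply: le_trans wu; apply: hw2 => //; rewrite im.
    move=> j' h; apply: le_trans hu _; apply: hv' => //; lia.
  exists w, e, d; split=> //.
  - rewrite SSE; apply: monic_degDl => //.
    by case: hX' => _ ->; nia.
  - by rewrite mulSn; lia.
  - split=> // m /andP[im]; rewrite ltnS leq_eqVlt => /orP[/eqP->|mj] dm.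
      by apply: le_trans (ltW uw); exact: hFu.
    by apply: hw2 => //; rewrite im.
  by move=> j' h; apply: hw3; lia.
right; exists (q j + w), e, (be j + d)%N; split.
- exact: monic_degM (monic_degXn _) hS.
- by rewrite PoszD dE beE // /a; lia.
- by rewrite /e0 in le_e *; nia.
- by have := hw3 j; rewrite leqnn jn => /(_ isT); lia.
move=> /[dup] Fij /hF[h|[m hm [dm h]]]; first lia.
by have := hw2 m hm dm; lia.
Qed.

End Realization.

(** * Pfaffians *)

Section ListPfaffian.

Variables (A : comNzRingType) (T : eqType) (w : T -> T -> A).

(* The alternation of [pf] reduces to the fact that, as operators on functions
   of lists, two contractions anticommute. *)
Fixpoint contract (x : T) (g : seq T -> A) (s : seq T) : A :=
  if s is y :: r then w x y * g r - contract x (g \o cons y) r else 0.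

(** Expansion along the first element, with [m] bounding the depth of recursion. Lists of odd length
    get [0], because [contract] vanishes on the empty list. *)
Fixpoint pf (m : nat) (s : seq T) : A :=
  if m is m'.+1 then (if s is x :: r then contract x (pf m') r else 1)
  else (s == [::])%:R.

Lemma eq_contract x g h : g =1 h -> contract x g =1 contract x h.
Proof.
move=> gh s; elim: s g h gh => //= y r IH g h gh.
by rewrite gh (IH _ (h \o cons y)) // => t /=; rewrite gh.
Qed.

Lemma contract0 x s : contract x (fun=> 0) s = 0.
Proof.
elim: s => //= y r IH; rewrite mulr0 sub0r.
by rewrite (@eq_contract _ _ (fun=> 0)) ?IH ?oppr0.
Qed.

Lemma contractD x c g h s :
  contract x (fun t => c * g t + h t) s = c * contract x g s + contract x h s.
Proof.
elim: s g h => [|y r IH] g h /=; first by rewrite mulr0 addr0.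
rewrite (@eq_contract _ _ (fun t => c * g (y :: t) + h (y :: t))) // IH.
by rewrite /comp; ring.
Qed.

Lemma contractN x g s : contract x (fun t => - g t) s = - contract x g s.
Proof.
rewrite (@eq_contract _ _ (fun t => -1 * g t + 0)); last first.
  by move=> t; rewrite mulN1r addr0.
by rewrite (@contractD _ _ g (fun=> 0)) contract0 mulN1r addr0.
Qed.

Lemma contract_anti x y g s :
  contract x (contract y g) s = - contract y (contract x g) s.
Proof.
elim: s g => [|z r IH] g /=; first by rewrite oppr0.
rewrite (@eq_contract x (contract y g \o cons z)
  (fun t => w y z * g t + - contract y (g \o cons z) t)) //.
rewrite (@eq_contract y (contract x g \o cons z)
  (fun t => w x z * g t + - contract x (g \o cons z) t)) //.
by rewrite !contractD !contractN IH; ring.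
Qed.

(** Anticommutation only shows that twice this expression is zero, which is void in characteristic
    two. *)
Lemma contract_self x g s : contract x (contract x g) s = 0.
Proof.
elim: s g => //= z r IH g.
rewrite (@eq_contract x (contract x g \o cons z)
  (fun t => w x z * g t + - contract x (g \o cons z) t)) //.
by rewrite !contractD !contractN IH; ring.
Qed.

Definition swap_anti (g : seq T -> A) : Prop := forall s1 y z s2,
  g (s1 ++ y :: z :: s2) = - g (s1 ++ z :: y :: s2).

Lemma contract_swap x g : swap_anti g -> swap_anti (contract x g).
Proof.
move=> gA s1; elim: s1 g gA => [|u s1 IH] g gA y z s2 /=.
  rewrite (@eq_contract x _ (fun t => - g (z :: y :: t))); last first.
    by move=> t; exact: (gA [::]).
  by rewrite contractN; rewrite /comp; ring.
rewrite gA (IH (g \o cons u)); first by ring.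
by move=> t1 y' z' t2; exact: (gA (u :: t1)).
Qed.

(** In characteristic two, this does not follow from skewness. *)
Hypothesis w_alt : forall x, w x x = 0.
Hypothesis w_skew : forall x y, w y x = - w x y.

Lemma pf_swap m : swap_anti (pf m).
Proof.
elim: m => [|m IH] s1 y z s2 /=; first by case: s1 => [|u s1] /=; rewrite oppr0.
case: s1 => [|u s1] /=; last exact: contract_swap.
rewrite (w_skew z y) mulNr opprD !opprK; congr (_ + _); case: m IH => [|m] IH.
  by rewrite !(@eq_contract _ _ (fun=> 0)) ?contract0 ?oppr0.
by rewrite /= (@contract_anti y z) opprK.
Qed.

Lemma pf_dup m x s : pf m (x :: x :: s) = 0.
Proof.
case: m => [|m] //=; rewrite w_alt mul0r sub0r; apply/eqP; rewrite oppr_eq0.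
case: m => [|m]; first by rewrite (@eq_contract _ _ (fun=> 0)) ?contract0.
by rewrite /= contract_self.
Qed.

Lemma pf_front m s1 x s2 :
  pf m (s1 ++ x :: s2) = (-1) ^+ size s1 * pf m (x :: s1 ++ s2).
Proof.
elim/last_ind: s1 s2 => [|s1 y IH] s2; first by rewrite mul1r.
by rewrite !cat_rcons pf_swap IH size_rcons exprS mulN1r mulNr.
Qed.

Lemma pf_mem m x s : x \in s -> pf m (x :: s) = 0.
Proof.
case/splitPr => s1 s2; rewrite -cat_cons pf_front.
by rewrite cat_cons pf_dup mulr0.
Qed.

Lemma contract_lin (I : Type) (r : seq I) (c : I -> A) (x : I -> T) g s :
  \sum_(i <- r) c i * contract (x i) g s =
  \sum_(p < size s) (-1) ^+ p * (\sum_(i <- r) c i * w (x i) (tnth (in_tuple s) p))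
     * g (take p s ++ drop p.+1 s).
Proof.
elim: s g => [|y s IH] g; first by rewrite big_ord0 big1 //= => i _; rewrite mulr0.
rewrite big_ord_recl /= expr0 mul1r drop0 (tnth_nth y) /=.
under eq_bigr => i _ do rewrite mulrBr mulrA.
rewrite sumrB mulr_suml IH; congr (_ + _); rewrite -sumrN.
apply: eq_bigr => p _; rewrite exprS mulN1r !mulNr; congr (- (_ * _ * _)).
by apply: eq_bigr => i _; rewrite !(tnth_nth y).
Qed.

(** Move [x] to the front and replace it by the combination of all [z] with coefficients [c z]: for
    [z] other than [x] the added term has a repeated element and vanishes, while the whole
    combination vanishes by linearity of [contract] and the dependency. *)
Lemma pf_dependent m (s : seq T) (c : T -> A) (x : T) :
    (size s <= m)%N -> uniq s -> x \in s ->
    (forall y, y \in s -> \sum_(z <- s) c z * w z y = 0) ->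
  c x * pf m s = 0.
Proof.
case: m => [|m]; first by case: s.
move=> sm us xs h; case/splitPr: xs us h sm => s1 s2 us h sm.
rewrite pf_front mulrCA.
suff -> : c x * pf m.+1 (x :: s1 ++ s2) = 0 by rewrite mulr0.
have -> : c x * pf m.+1 (x :: s1 ++ s2) =
    \sum_(z <- s1 ++ x :: s2) c z * contract z (pf m) (s1 ++ s2).
  rewrite (bigD1_seq x) //=; last by rewrite mem_cat mem_head orbT.
  rewrite big_seq_cond big1 ?addr0 // => z /andP[zs zx].
  have := @pf_mem m.+1 z (s1 ++ s2); rewrite /= => ->; first by rewrite mulr0.
  by move: zs; rewrite !mem_cat inE (negPf zx).
rewrite contract_lin big1 // => p _; rewrite h ?mulr0 ?mul0r //.
have := mem_tnth p (in_tuple (s1 ++ s2)).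
by rewrite !mem_cat inE => /orP[|] ->; rewrite ?orbT.
Qed.

End ListPfaffian.

(** * Perfect matchings and their crossing numbers *)

Section Matchings.

Context {n : nat}.
Implicit Types (e f : edge n) (E C : {set edge n}) (U : {set 'I_n}).

Lemma edge_lt e : ((val e).1 < (val e).2)%N.
Proof. exact: (valP e). Qed.

Lemma edge_eqP e f :
  (val e).1 = (val f).1 -> (val e).2 = (val f).2 -> e = f.
Proof.
move=> h1 h2; apply: val_inj.
by rewrite [LHS]surjective_pairing [RHS]surjective_pairing h1 h2.
Qed.

Lemma mem_ends e u : (u \in ends e) = (u == (val e).1) || (u == (val e).2).
Proof. by rewrite !inE. Qed.

Lemma ends_inj : injective (@ends n).
Proof.
move=> e f ef; have le := edge_lt e; have lf := edge_lt f.
have : (val e).1 \in ends f by rewrite -ef mem_ends eqxx.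
have : (val e).2 \in ends f by rewrite -ef mem_ends eqxx orbT.
rewrite !mem_ends => /orP[|]/eqP h2 /orP[|]/eqP h1; apply: edge_eqP => //;
  by rewrite h1 h2 in le; lia.
Qed.

Lemma cross_sym e f : cross e f = cross f e.
Proof.
by rewrite /cross; case: (val e) => a b; case: (val f) => c d; rewrite orbC.
Qed.

Lemma crossE e f : cross e f =
  ([&& (val e).1 < (val f).1, (val f).1 < (val e).2 & (val e).2 < (val f).2]
  || [&& (val f).1 < (val e).1, (val e).1 < (val f).2 & (val f).2 < (val e).2])%N.
Proof. by rewrite /cross; case: (val e) => a b; case: (val f). Qed.

Lemma perfect_matchingP U E : reflect
  [/\ forall e, e \in E -> ends e \subset U,
      forall u, u \in U -> exists2 e, e \in E & u \in ends e &
      forall e f u, e \in E -> f \in E -> u \in ends e -> u \in ends f -> e = f]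
  (perfect_matching U E).
Proof.
apply: (iffP and3P) => [[/eqP cov /trivIsetP triv _]|[h1 h2 h3]].
  split=> [e eE|u|e f u eE fE ue uf].
  - by rewrite -cov; apply: (bigcup_max (ends e)) => //; apply: imset_f.
  - by rewrite -cov => /bigcupP[_ /imsetP[e eE ->] ue]; exists e.
  apply: ends_inj; apply: contraTeq uf => ne.
  have := triv _ _ (imset_f _ eE) (imset_f _ fE) ne.
  by move/disjointFr => ->.
split.
- rewrite eqEsubset; apply/andP; split.
    by apply/bigcupsP => _ /imsetP[e eE ->]; apply: h1.
  apply/subsetP => u /h2[e eE ue]; apply/bigcupP; exists (ends e) => //.
  exact: imset_f.
- apply/trivIsetP => _ _ /imsetP[e eE ->] /imsetP[f fE ->] ne.
  rewrite disjoint_subset; apply/subsetP => u ue; rewrite inE; apply/negP => uf.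
  by move: ne; rewrite (h3 e f u) ?eqxx.
apply/negP => /imsetP[e _ /setP/(_ (val e).1)].
by rewrite inE mem_ends eqxx.
Qed.

Lemma matching_sum_nat U E (F : 'I_n -> nat) : perfect_matching U E ->
  (\sum_(u in U) F u = \sum_(e in E) (F (val e).1 + F (val e).2))%N.
Proof.
case/and3P => /eqP <- triv _; rewrite big_trivIset //=.
rewrite big_imset => [|e f _ _]; last exact: ends_inj.
apply: eq_bigr => e _; rewrite big_setU1 ?big_set1 // inE.
by apply/eqP => h; have := edge_lt e; rewrite h ltnn.
Qed.

Lemma card_matching U E : perfect_matching U E -> #|U| = (2 * #|E|)%N.
Proof.
move=> /(matching_sum_nat (fun=> 1%N)).
by rewrite sum1_card big_const iter_addn_0.
Qed.

Lemma matching_add U E e : ends e \subset U -> perfect_matching (U :\: ends e) E ->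
  e \notin E /\ perfect_matching U (e |: E).
Proof.
move=> eU /perfect_matchingP[h1 h2 h3].
have dis f u : f \in E -> u \in ends f -> u \notin ends e.
  by move=> /h1/subsetP h /h; rewrite inE => /andP[].
have eE : e \notin E.
  apply/negP => eE; have := dis e (val e).1 eE.
  by rewrite mem_ends eqxx => /(_ isT).
split=> //; apply/perfect_matchingP; split=> [f|u uU|f g u].
- by rewrite !inE => /orP[/eqP->//|/h1]; rewrite subsetD => /andP[].
- have [ue|ue] := boolP (u \in ends e); first by exists e; rewrite ?setU11.
  have [|f fE uf] := h2 u; first by rewrite inE ue.
  by exists f => //; rewrite setU1r.
move=> /setU1P[->|fE] /setU1P[->|gE] //.
- by move=> ue ug; have := dis _ _ gE ug; rewrite ue.
- by move=> uf ue; have := dis _ _ fE uf; rewrite ue.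
exact: h3.
Qed.

Lemma matching_del U E e : e \in E -> perfect_matching U E ->
  perfect_matching (U :\: ends e) (E :\ e).
Proof.
move=> eE /perfect_matchingP[h1 h2 h3]; apply/perfect_matchingP; split.
- move=> f; rewrite !inE => /andP[fe fE]; apply/subsetP => u uf.
  rewrite inE (subsetP (h1 f fE)) // andbT; apply: contraNN fe => ue.
  by rewrite (h3 f e u).
- move=> u; rewrite inE => /andP[ue /h2[f fE uf]]; exists f => //.
  by rewrite !inE fE andbT; apply: contraNneq ue => <-.
by move=> f g u /setD1P[_ fE] /setD1P[_ gE]; apply: h3.
Qed.

Lemma is_crossingP m C : reflect
  (#|C| = m /\ forall e f, e \in C -> f \in C -> e != f -> cross e f)
  (is_crossing m C).
Proof.
apply: (iffP andP) => [[/eqP cC /forall_inP h]|[cC h]]; split=> //.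
- by move=> e f eC fC; apply/implyP; apply: (forall_inP (h e eC)).
- exact/eqP.
by apply/forall_inP => e eC; apply/forall_inP => f fC; apply/implyP; apply: h.
Qed.

(** The crossing pairs containing [e] correspond to the edges of [E] that cross it. *)
Lemma cr_add e E : e \notin E ->
  cr (e |: E) = (cr E + #|[set f in E | cross e f]|)%N.
Proof.
move=> eE; rewrite /cr -(cardsID [set C : {set edge n} | e \notin C]); congr (_ + _)%N.
  apply: eq_card => C; rewrite !inE; have [eC|eC] := boolP (e \in C).
    rewrite andbF; apply/esym/negbTE; rewrite negb_and; apply/orP; left.
    by apply: contra eE => /subsetP; apply.
  rewrite andbT; congr (_ && _).
  apply/subsetP/subsetP => h f fC; last by rewrite setU1r ?h.
  by have := h f fC; rewrite !inE => /orP[/eqP fe|//]; rewrite -fe fC in eC.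
rewrite -(card_in_imset (f := fun f => [set e; f])); last first.
  move=> f g; rewrite !inE => /andP[fE _] /andP[gE _] /setP/(_ f).
  rewrite !inE eqxx orbT => /esym/orP[/eqP fe|/eqP//].
  by rewrite -fe fE in eE.
apply: eq_card => C; rewrite !inE negbK.
apply/and3P/imsetP => [[eC sub /is_crossingP[cC crC]]|[f]].
  have /cards1P[f Cf] : #|C :\ e| == 1%N.
    by move: cC; rewrite (cardsD1 e) eC add1n => -[->].
  have : f \in C :\ e by rewrite Cf inE.
  rewrite !inE => /andP[fe fC]; exists f; last first.
    by rewrite -Cf setD1K.
  rewrite inE (crC e f) // 1?eq_sym // andbT.
  by have := subsetP sub f fC; rewrite !inE (negPf fe).
rewrite inE => /andP[fE ef ->]; split.
- by rewrite setU11.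
- by apply/subsetP => g; rewrite !inE => /orP[->//|/eqP->]; rewrite fE orbT.
have ne : e != f by apply: contraNneq eE => ->.
apply/is_crossingP; split=> [|g h]; first by rewrite cards2 ne.
rewrite !inE => /orP[|]/eqP-> /orP[|]/eqP->; rewrite ?eqxx // => _.
by rewrite cross_sym.
Qed.

End Matchings.

(** * Signed sums over matchings *)

Section MatchingSum.

Context {n : nat} {A : comNzRingType}.
Implicit Types (e f : edge n) (E C : {set edge n}) (U : {set 'I_n}).

Definition matching_sum (x : edge n -> A) U : A :=
  \sum_(E : {set edge n} | perfect_matching U E) (-1) ^+ cr E * \prod_(e in E) x e.

(** All ends are above the lower end of [e], so an edge crosses [e] exactly when one of its two ends
    is below the upper end; edges with both ends there do not affect the parity. *)
Lemma cross_parity U E e : perfect_matching U E ->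
    (forall u, u \in U -> (val e).1 < u)%N -> (val e).2 \notin U ->
  (-1) ^+ #|[set f in E | cross e f]| =
  (-1) ^+ #|[set u in U | (u < (val e).2)%N]| :> A.
Proof.
move=> pm lt eU; have := matching_sum_nat (fun u => (u < (val e).2)%N : nat) pm.
have -> : (\sum_(u in U) (u < (val e).2)%N = #|[set u in U | (u < (val e).2)%N]|)%N.
  rewrite -sum1_card [RHS](eq_bigl (fun u => (u \in U) && (u < (val e).2)%N)).
    by rewrite big_mkcondr.
  by move=> u; rewrite inE.
move=> ->; rewrite expr_sum.
have -> : #|[set f in E | cross e f]| = (\sum_(f in E) cross e f)%N.
  rewrite -sum1_card [LHS](eq_bigl (fun f => (f \in E) && cross e f)).
    by rewrite big_mkcondr.
  by move=> u; rewrite inE.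
rewrite expr_sum; apply: eq_bigr => f fE.
have [h1 _ _] := perfect_matchingP _ _ pm; have /subsetP sub := h1 f fE.
have i1 := sub (val f).1; have i2 := sub (val f).2.
rewrite !mem_ends eqxx /= in i1; rewrite !mem_ends eqxx orbT in i2.
have {}i1 := i1 isT; have {}i2 := i2 isT.
have l1 := lt _ i1; have l2 := lt _ i2; have lf := edge_lt f.
have n1 : (val f).1 != (val e).2 :> nat.
  by apply: contraNneq eU => /val_inj <-.
have n2 : (val f).2 != (val e).2 :> nat.
  by apply: contraNneq eU => /val_inj <-.
rewrite crossE l1 /= [in X in _ || X]ltnNge (ltnW l1) /= orbF.
case: (ltnP (val f).1 (val e).2) => c1; case: (ltnP (val f).2 (val e).2) => c2.
- by rewrite ltnNge (ltnW c2) /= expr0 addn1 sqrrN expr1n.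
- by rewrite ltn_neqAle eq_sym n2 c2.
- by move: (leq_ltn_trans c1 lf); rewrite ltnNge (ltnW c2).
by [].
Qed.

(** Matchings are sorted by the edge at the smallest vertex [i]. Removing it leaves a matching of
    the other vertices, and [cross_parity] gives the change of sign. *)
Lemma matching_sum_expand (x : edge n -> A) U (i : 'I_n) : i \in U ->
    (forall u, u \in U -> i <= u)%N ->
  matching_sum x U = \sum_(e : edge n | ((val e).1 == i) && ((val e).2 \in U))
    (-1) ^+ #|[set u in U | (i < u < (val e).2)%N]| * x e
      * matching_sum x (U :\: ends e).
Proof.
move=> iU imin.
transitivity (\sum_(E | perfect_matching U E) \sum_(e | ((val e).1 == i) && (e \in E))
   (-1) ^+ cr E * \prod_(e in E) x e).
  apply: eq_bigr => E /perfect_matchingP[h1 h2 h3].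
  have [e0 e0E ie0] := h2 i iU.
  have e0i : (val e0).1 = i.
    have := edge_lt e0; have := imin (val e0).1.
    rewrite (subsetP (h1 _ e0E)) ?mem_ends ?eqxx // => /(_ isT).
    by move: ie0; rewrite mem_ends => /orP[|]/eqP -> // l1 l2; rewrite leqNgt l2 in l1.
  rewrite [RHS](big_pred1 e0) // => e; apply/andP/eqP => [[/eqP ei eE]|->].
    by apply: (h3 e e0 i) => //; rewrite mem_ends ?ei ?e0i eqxx.
  by rewrite e0i eqxx.
rewrite (exchange_big_dep (fun e => ((val e).1 == i) && ((val e).2 \in U))) /=; last first.
  move=> E e /perfect_matchingP[h1 _ _] /andP[-> eE] /=.
  by rewrite (subsetP (h1 _ eE)) // mem_ends eqxx orbT.
apply: eq_bigr => e /andP[/eqP ei e2U].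
have eU : ends e \subset U.
  by apply/subsetP => u; rewrite mem_ends => /orP[|]/eqP -> //; rewrite ei.
rewrite /matching_sum mulr_sumr.
rewrite (reindex_onto (fun E => e |: E) (fun E => E :\ e)) /=; last first.
  by move=> E /and3P[_ _ eE]; rewrite setD1K.
apply: eq_big => [E|E].
  rewrite setU11 andbT ei eqxx andbT.
  apply/andP/idP => [[pm /eqP EE]|pm].
    by rewrite -EE; apply: matching_del => //; rewrite setU11.
  by have [eE ->] := matching_add eU pm; rewrite setU1K.
move=> /andP[/and3P[pm _ _] /eqP EE].
have eE : e \notin E by rewrite -EE !inE eqxx.
rewrite (cr_add eE) exprD big_setU1 //= -!mulrA; rewrite mulrCA; congr (_ * _); last first.
  by rewrite mulrCA.
rewrite (@cross_parity (U :\: ends e)).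
- congr (_ ^+ _); apply: eq_card => u; rewrite !inE.
  have := edge_lt e; rewrite ei => lt.
  have [->|ui] := eqVneq u i; first by rewrite ltnn andbF.
  have [->|ue] := eqVneq u (val e).2; first by rewrite ltnn !andbF.
  have [uU|//] := boolP (u \in U); rewrite /=.
  have := imin u uU; rewrite leq_eqVlt eq_sym => /orP[/eqP/val_inj uu|-> //].
  by rewrite uu eqxx in ui.
- by rewrite -EE; apply: matching_del => //; rewrite setU11.
- move=> u; rewrite !inE => /andP[]; rewrite negb_or ei => /andP[ui _] /imin.
  by rewrite leq_eqVlt eq_sym => /orP[/eqP/val_inj uu|//]; rewrite uu eqxx in ui.
by rewrite !inE eqxx orbT.
Qed.

End MatchingSum.

(** * Signed matching sums as recursive Pfaffians *)

Lemma contract_uniq (A : comNzRingType) (T : eqType) (w : T -> T -> A) x g s :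
  uniq s -> contract w x g s =
    \sum_(j <- s) (-1) ^+ index j s * w x j * g (rem j s).
Proof.
elim: s g => [|y s IH] g; first by rewrite big_nil.
rewrite cons_uniq => /andP[ys us] /=; rewrite big_cons /= eqxx mul1r IH //.
congr (_ + _); rewrite -sumrN; apply: eq_big_seq => j js.
have /negbTE -> : y != j by apply: contraNneq ys => ->.
by rewrite exprS mulN1r !mulNr.
Qed.

Section EnumSet.

Context {n : nat}.
Implicit Types (U : {set 'I_n}).

Lemma sorted_enum_set U : sorted (fun i j : 'I_n => i < j)%N (enum U).
Proof.
rewrite /enum_mem; apply: sorted_filter => [y x z|]; first exact: ltn_trans.
have : sorted ltn (map val (enum 'I_n)) by rewrite val_enum_ord iota_ltn_sorted.
by rewrite sorted_map -enumT.
Qed.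

Lemma index_sorted_ord (s : seq 'I_n) (j : 'I_n) :
  sorted (fun i j : 'I_n => i < j)%N s -> j \in s ->
  index j s = count (fun u : 'I_n => u < j)%N s.
Proof.
elim: s => //= y s IH ps; rewrite inE.
have tr : transitive (fun i j : 'I_n => i < j)%N.
  by move=> a b c; exact: ltn_trans.
have /allP lt_y := order_path_min tr ps.
have [->|jy /= js] := eqVneq j y.
  move=> _; rewrite ltnn add0n; apply/esym/eqP; rewrite -leqn0 leqNgt -has_count.
  by apply/hasPn => u /lt_y h; rewrite -leqNgt ltnW.
by rewrite lt_y // IH ?(path_sorted ps).
Qed.

Variables (A : comNzRingType) (w : 'I_n -> 'I_n -> A).

Lemma matching_sum0 (x : edge n -> A) : matching_sum x set0 = 1.
Proof.
rewrite /matching_sum (big_pred1 set0) => [|E].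
  rewrite big_set0 mulr1 /cr (_ : [set _ | _] = set0) ?cards0 //.
  apply/setP => C; rewrite !inE subset0; apply/negbTE; rewrite negb_and.
  by case: eqP => //= ->; rewrite /is_crossing cards0.
apply/idP/eqP => [/card_matching|->].
  by rewrite cards0 => /esym/eqP; rewrite muln_eq0 /= cards_eq0 => /eqP.
by apply/perfect_matchingP; split=> [e|u|e f u]; rewrite inE.
Qed.

(** Both sides are expanded along the smallest vertex, the head of [enum U]. The signs agree because
    the index of [j] in the sorted tail counts the vertices strictly between. *)
Lemma matching_sum_pf m U : (#|U| <= m)%N ->
  matching_sum (fun e => w (val e).1 (val e).2) U = pf w m (enum U).
Proof.
elim: m U => [|m IH] U leU.
  move: leU; rewrite leqn0 cards_eq0 => /eqP ->.
  by rewrite matching_sum0 enum_set0 /=.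
have := sorted_enum_set U; have := enum_uniq U; have := mem_enum U.
rewrite cardE in leU; case Eu: (enum U) leU => [|i r] leU memU.
  suff -> : U = set0 by rewrite matching_sum0.
  by apply/setP => u; rewrite -memU inE.
rewrite cons_uniq => /andP[ir ur] sor.
have tr : transitive (fun i j : 'I_n => i < j)%N.
  by move=> a b c; exact: ltn_trans.
have /allP lt_i := order_path_min tr sor.
have iU : i \in U by rewrite -memU mem_head.
have rE j : (j \in r) = (j \in U) && (i < j)%N.
  rewrite -memU inE; have [->|ji] := eqVneq j i; first by rewrite ltnn andbF (negPf ir).
  by case: (boolP (j \in r)) => //= /lt_i ->.
rewrite (matching_sum_expand _ iU); last first.
  by move=> u; rewrite -memU inE => /orP[/eqP->//|/lt_i/ltnW].
rewrite [RHS]contract_uniq // big_uniq //=.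
rewrite (partition_big (fun e : edge n => (val e).2) (mem r)) /=; last first.
  by move=> e /andP[/eqP ei eU]; rewrite rE eU -ei edge_lt.
apply: eq_bigr => j jr; have := jr; rewrite rE => /andP[jU ij].
rewrite (big_pred1 (mkedge ij)) => [|e] /=; last first.
  apply/andP/eqP => [[/andP[/eqP e1 _] /eqP e2]|->]; first exact: edge_eqP.
  by rewrite /= eqxx jU eqxx.
have remE : rem j r = enum (U :\: ends (mkedge ij)).
  rewrite rem_filter // /enum_mem -enumT.
  have -> : r = filter (predC1 i) (enum U).
    rewrite Eu /= eqxx /=; apply/esym/all_filterP/allP => u /lt_i lt.
    by rewrite /= -val_eqE /= gtn_eqF.
  rewrite {1}/enum_mem -enumT -!filter_predI; apply: eq_filter => u; rewrite /= !inE.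
  by rewrite /= negb_or [(u != j) && _]andbC.
congr (_ ^+ _ * _ * _); last first.
  rewrite remE; apply: IH; rewrite cardE -remE size_rem //.
  by apply: leq_trans (leq_pred _) _; exact: leU.
rewrite (index_sorted_ord (path_sorted sor) jr) -size_filter.
rewrite cardE; apply: perm_size; apply: uniq_perm; first exact: enum_uniq.
  by rewrite filter_uniq.
move=> u.
by rewrite mem_enum mem_filter inE rE andbA andbC.
Qed.

End EnumSet.

(** * Vanishing of Pfaffians in low rank *)

Section Vanishing.

Context {n : nat}.

(** The entries are bilinear in the vectors [(a i, b i)] of length [2 k]. More than [2 k] of these
    are linearly dependent, and the dependency also annihilates the rows of [w], so [pf_dependent]
    applies at a nonzero coefficient. *)
Lemma matching_sum_low_rank (A : fieldType) (k : nat) (a b : 'I_n -> nat -> A)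
    (U : {set 'I_n}) : (2 * k < #|U|)%N ->
  matching_sum (fun e : edge n =>
    \sum_(l < k) (a (val e).1 l * b (val e).2 l - a (val e).2 l * b (val e).1 l)) U = 0.
Proof.
move=> ltU; pose w (i j : 'I_n) := \sum_(l < k) (a i l * b j l - a j l * b i l).
rewrite (@matching_sum_pf n A w #|U|) //.
have w_alt i : w i i = 0 by rewrite /w big1 // => l _; rewrite subrr.
have w_skew i j : w j i = - w i j.
  by rewrite /w -sumrN; apply: eq_bigr => l _; rewrite opprB.
pose Z : 'M[A]_(#|U|, k + k) := \matrix_(s, t)
  match split t with inl l => a (enum_val s) l | inr l => b (enum_val s) l end.
have /rowV0Pn[c cZ cn0] : kermx Z != 0.
  rewrite -mxrank_eq0 mxrank_ker -lt0n subn_gt0.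
  by apply: leq_ltn_trans (rank_leq_col Z) _; rewrite addnn -mul2n.
have {}cZ : c *m Z = 0 by apply/sub_kermxP.
have [s cs] : exists s, c 0 s != 0.
  apply/existsP; apply: contraNT cn0 => /existsPn h; apply/eqP/rowP => s.
  by rewrite mxE; apply/eqP; have := h s; rewrite negbK.
pose c' (i : 'I_n) := \sum_(s | enum_val s == i) c 0 s.
have c'E t : c' (enum_val t) = c 0 t.
  by rewrite /c' (big_pred1 t) // => t'; rewrite (inj_eq enum_val_inj).
have sumE (f : 'I_n -> A) : \sum_(z <- enum U) c' z * f z = \sum_t c 0 t * f (enum_val t).
  rewrite big_enum /= big_enum_val /=.
  by apply: eq_bigr => t _; rewrite c'E.
have sa l : (l < k)%N -> \sum_(z <- enum U) c' z * a z l = 0.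
  move=> lk; rewrite sumE; have /matrixP/(_ 0 (lshift k (Ordinal lk))) := cZ.
  rewrite [LHS]mxE [RHS]mxE => h; rewrite -[RHS]h; apply: eq_bigr => t _; rewrite mxE.
  by rewrite (unsplitK (inl _)).
have sb l : (l < k)%N -> \sum_(z <- enum U) c' z * b z l = 0.
  move=> lk; rewrite sumE; have /matrixP/(_ 0 (rshift k (Ordinal lk))) := cZ.
  rewrite [LHS]mxE [RHS]mxE => h; rewrite -[RHS]h; apply: eq_bigr => t _; rewrite mxE.
  by rewrite (unsplitK (inr _)).
have := @pf_dependent _ _ w w_alt w_skew #|U| (enum U) c' (enum_val s).
rewrite -cardE leqnn enum_uniq mem_enum enum_valP c'E => /(_ isT isT isT) h.
suff : c 0 s * pf w #|U| (enum U) = 0.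
  by move/eqP; rewrite mulf_eq0 (negPf cs) => /eqP.
apply: h => y _.
under eq_bigr => z _ do rewrite /w mulr_sumr.
rewrite exchange_big /= big1 // => l _.
under eq_bigr => z _ do rewrite mulrBr mulrA [a y l * _]mulrC mulrA.
by rewrite sumrB -!mulr_suml sa ?sb // !mul0r subrr.
Qed.

End Vanishing.

(** * Standard monomials are linearly independent *)

Definition msupport n (m : edge_monom n) : {set edge n} :=
  [set e | (0 < m (enum_rank e))%N].

Definition wdeg n (f : edge n -> nat) (m : edge_monom n) : nat :=
  (\sum_e m (enum_rank e) * f e)%N.

(** * Evaluation of edge polynomials *)

Section Substitution.

Context {n : nat} {K : fieldType}.

Lemma prod_edges (S : comNzRingType) (Y : edge n -> S) (m : edge_monom n) :
  mmap1 (fun i => Y (enum_val i)) m = \prod_e Y e ^+ m (enum_rank e).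
Proof.
rewrite /mmap1 (reindex (@enum_rank (edge n))) /=; last exact/onW_bij/enum_rank_bij.
by apply: eq_bigr => e _; rewrite enum_rankK.
Qed.

Lemma mdeg_edges (m : edge_monom n) : mdeg m = wdeg (fun=> 1%N) m.
Proof.
rewrite mdegE /wdeg (reindex (@enum_rank (edge n))) /=; last exact/onW_bij/enum_rank_bij.
by apply: eq_bigr => e _; rewrite muln1.
Qed.

Lemma mmap_pfaffian (S : comNzRingType) (h : {rmorphism K -> S}) (Y : edge n -> S) U :
  mmap h (fun i => Y (enum_val i)) (@pfaffian K n U) = matching_sum Y U.
Proof.
rewrite /pfaffian /matching_sum rmorph_sum; apply: eq_bigr => E _.
rewrite rmorphM rmorphXn rmorphN1 rmorph_prod; congr (_ * _).
by apply: eq_bigr => e _; rewrite /= mmapX mmap1U enum_rankK.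
Qed.

Lemma mmap_pfaffian_ideal (S : comNzRingType) (h : {rmorphism K -> S})
    (Y : edge n -> S) k (f : edge_poly K n) :
    (forall U : {set 'I_n}, #|U| = (2 * k + 2)%N -> matching_sum Y U = 0) ->
  pfaffian_ideal k f -> mmap h (fun i => Y (enum_val i)) f = 0.
Proof.
move=> Y0 [s sP ->]; rewrite rmorph_sum big_seq big1 // => p ps.
by have [U cU e2] := sP p ps; rewrite /= rmorphM e2 /= mmap_pfaffian Y0 ?mulr0.
Qed.

Lemma matching_sum_morph (S S' : comNzRingType) (h : {rmorphism S -> S'})
    (Y : edge n -> S) U :
  h (matching_sum Y U) = matching_sum (fun e => h (Y e)) U.
Proof.
rewrite /matching_sum rmorph_sum; apply: eq_bigr => E _.
by rewrite rmorphM rmorphXn rmorphN1 rmorph_prod.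
Qed.

Lemma matching_sum_low_rank_dom (D : idomainType) k (a b : 'I_n -> nat -> D)
    (U : {set 'I_n}) : (2 * k < #|U|)%N ->
  matching_sum (fun e : edge n =>
    \sum_(l < k) (a (val e).1 l * b (val e).2 l - a (val e).2 l * b (val e).1 l)) U = 0.
Proof.
move=> ltU; apply/eqP; rewrite -tofrac_eq0; apply/eqP.
rewrite (matching_sum_morph (@FracField.tofrac D)).
rewrite -[RHS](matching_sum_low_rank (fun i l => FracField.tofrac (a i l)) (fun i l => FracField.tofrac (b i l)) ltU).
apply: eq_bigr => E _; congr (_ * _); apply: eq_bigr => e _.
by rewrite rmorph_sum; apply: eq_bigr => l _; rewrite rmorphB !rmorphM.
Qed.

End Substitution.

Lemma digits_lt (D N : nat) (a : nat -> nat) : (forall t, a t < D)%N ->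
  (\sum_(t < N) a t * D ^ t < D ^ N)%N.
Proof.
move=> aD; elim: N => [|N IH]; first by rewrite big_ord0.
rewrite big_ord_recr /= expnS; apply: leq_trans (_ : a N * D ^ N + D ^ N <= _)%N.
  by rewrite addnC ltn_add2l.
by rewrite -mulSnr leq_mul2r aD orbT.
Qed.

Lemma digits_inj (D N : nat) (a b : nat -> nat) :
    (forall t, a t < D)%N -> (forall t, b t < D)%N ->
    (\sum_(t < N) a t * D ^ t = \sum_(t < N) b t * D ^ t)%N ->
  forall t, (t < N)%N -> a t = b t.
Proof.
move=> aD bD; elim: N => // N IH; rewrite !big_ord_recr /= => eq_ab.
have la := digits_lt N aD; have lb := digits_lt N bD.
have pos : (0 < D ^ N)%N by rewrite expn_gt0 (leq_ltn_trans _ (aD 0%N)).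
have eN : a N = b N.
  move: (congr1 (fun x => x %/ D ^ N)%N eq_ab); rewrite !(addnC (\sum_(_ < _) _)%N).
  by rewrite !divnMDl // !divn_small ?addn0.
move=> t; rewrite ltnS leq_eqVlt => /orP[/eqP->//|]; apply: IH.
by move: eq_ab; rewrite eN => /addIn.
Qed.

Lemma seq_argmax (T : eqType) (W : T -> nat) (s : seq T) : s != [::] ->
  exists2 x, x \in s & forall y, y \in s -> (W y <= W x)%N.
Proof.
elim: s => // a [|b s] IH _.
  by exists a; rewrite ?mem_head // => y; rewrite inE => /eqP ->.
have [x xs hx] := IH isT; have [le|lt] := leqP (W a) (W x).
  exists x; first by rewrite inE xs orbT.
  by move=> y; rewrite inE => /orP[/eqP->//|/hx].
exists a; first exact: mem_head.
by move=> y; rewrite inE => /orP[/eqP->//|/hx h]; exact: leq_trans h (ltnW lt).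
Qed.

(** * Faces as crossing-free relations *)

Section SupportRelation.

Context {n : nat}.

Definition support_rel (S : {set edge n}) : rel nat := fun i j =>
  [exists e : edge n, [&& e \in S, (val e).1 == i :> nat & (val e).2 == j :> nat]].

Lemma support_rel_lt S i j : support_rel S i j -> (i < j < n)%N.
Proof.
by case/existsP => e /and3P[_ /eqP <- /eqP <-]; rewrite edge_lt ltn_ord.
Qed.

Lemma support_relE S (e : edge n) : support_rel S (val e).1 (val e).2 = (e \in S).
Proof.
apply/existsP/idP => [[f /and3P[fS /eqP/val_inj h1 /eqP/val_inj h2]]|eS].
  by rewrite -(edge_eqP h1 h2).
by exists e; rewrite eS !eqxx.
Qed.

(** If [a k < b 0], all lower ends of the chain precede all upper ends, so its edges cross pairwise;
    they are distinct as no edge crosses itself. *)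
Lemma Ass_crossing_free k S : S \in Ass k -> crossing_free k (support_rel S).
Proof.
rewrite inE => /existsPn noC a b hF mono; rewrite leqNgt; apply/negP => lt_ab.
have mono_lt t t' : (t < t')%N -> (t' <= k)%N -> (a t < a t')%N && (b t < b t')%N.
  elim: t' => // t' IH; rewrite ltnS leq_eqVlt => /orP[/eqP->|lt] le; first exact: mono.
  by have := IH lt (ltnW le); have := mono _ le; lia.
have ex (t : 'I_k.+1) : exists e : edge n,
    [&& e \in S, (val e).1 == a t :> nat & (val e).2 == b t :> nat].
  by apply/existsP/hF; rewrite -ltnS.
have [c cP0] := fin_all_exists ex.
have cP t : [/\ c t \in S, (val (c t)).1 = a t :> nat & (val (c t)).2 = b t :> nat].
  by have /and3P[? /eqP ? /eqP ?] := cP0 t.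
have c_cross (t t' : 'I_k.+1) : (t < t')%N -> cross (c t) (c t').
  move=> tt'; have /andP[h1 h2] := mono_lt _ _ tt' (ltn_ord t').
  have le_a : (a t' <= a k)%N.
    have := ltn_ord t'; rewrite ltnS leq_eqVlt => /orP[/eqP->//|lt].
    by have := mono_lt _ _ lt (leqnn k); lia.
  have le_b : (b 0%N <= b t)%N.
    case: (posnP t) => [->//|lt].
    by have := mono_lt _ _ lt (ltn_ord t); lia.
  have [_ e1 e2] := cP t; have [_ e3 e4] := cP t'.
  by rewrite crossE e1 e2 e3 e4; lia.
have c_inj : injective c.
  move=> t t' ctt.
  have [lt|lt|eq] := ltngtP t t'; last exact: ord_inj.
    by have := c_cross _ _ lt; rewrite ctt crossE !ltnn.
  by have := c_cross _ _ lt; rewrite ctt crossE !ltnn.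
apply/negP: (noC [set c t | t : 'I_k.+1]); rewrite negbK; apply/andP; split.
  by apply/subsetP => _ /imsetP[t _ ->]; have [] := cP t.
apply/is_crossingP; split; first by rewrite card_imset // card_ord.
move=> _ _ /imsetP[t _ ->] /imsetP[t' _ ->] ne.
have [lt|lt|eq] := ltngtP t t'; first exact: c_cross.
  by rewrite cross_sym; apply: c_cross.
by rewrite (val_inj eq) eqxx in ne.
Qed.

End SupportRelation.

(** * Weights that separate monomials *)

Section Weights.

Context {n : nat}.
Implicit Types (e : edge n) (m : edge_monom n).

Lemma wdegD (f g : edge n -> nat) m :
  wdeg (fun e => f e + g e)%N m = (wdeg f m + wdeg g m)%N.
Proof. by rewrite -big_split; apply: eq_bigr => e _; rewrite mulnDr. Qed.

Lemma wdegZ c (f : edge n -> nat) m :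
  wdeg (fun e => c * f e)%N m = (c * wdeg f m)%N.
Proof. by rewrite /wdeg big_distrr; apply: eq_bigr => e _; rewrite mulnCA. Qed.

Lemma leq_wdeg (f g : edge n -> nat) m :
  (forall e, f e <= g e)%N -> (wdeg f m <= wdeg g m)%N.
Proof. by move=> fg; apply: leq_sum => e _; rewrite leq_mul. Qed.

Lemma mdeg_scale c m : wdeg (fun=> c) m = (c * mdeg m)%N.
Proof. by rewrite mdeg_edges -wdegZ; apply: eq_bigr => e _; rewrite muln1. Qed.

(** Distinct edges get distinct powers, so the exponents of a monomial of degree less than [D] are
    the base [D] digits of its weight and can be recovered from it. *)
Definition digit_weight (D : nat) (e : edge n) : nat :=
  D ^ ((val e).1 * n + (val e).2).

Lemma edge_code_lt e : ((val e).1 * n + (val e).2 < n * n)%N.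
Proof.
apply: leq_trans (_ : ((val e).1).+1 * n <= _)%N.
  by rewrite mulSn addnC ltn_add2r ltn_ord.
by rewrite leq_mul2r ltn_ord orbT.
Qed.

Lemma edge_code_inj e e' :
  ((val e).1 * n + (val e).2 = (val e').1 * n + (val e').2)%N -> e = e'.
Proof.
have n0 : (0 < n)%N := leq_ltn_trans (leq0n _) (ltn_ord (val e).1).
move=> eq; apply: edge_eqP; apply: val_inj => /=.
  have := congr1 (fun x => x %/ n)%N eq.
  by rewrite !divnMDl // !divn_small ?addn0.
by have := congr1 (fun x => x %% n)%N eq; rewrite !modnMDl !modn_small.
Qed.

Let digit m t := (\sum_(e : edge n | (val e).1 * n + (val e).2 == t) m (enum_rank e))%N.

Let digit_weightE D m :
  wdeg (digit_weight D) m = (\sum_(t < n * n) digit m t * D ^ t)%N.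
Proof.
under eq_bigr => t _ do rewrite /digit big_distrl /=.
rewrite (exchange_big_dep xpredT) //=; apply: eq_bigr => e _.
by rewrite (big_pred1 (Ordinal (edge_code_lt e))).
Qed.

Let digit_lt D m t : (mdeg m < D)%N -> (digit m t < D)%N.
Proof.
apply: leq_ltn_trans; rewrite mdeg_edges /wdeg /digit.
rewrite [X in (_ <= X)%N](bigID (fun e : edge n => (val e).1 * n + (val e).2 == t)%N) /=.
by under [X in (_ <= X + _)%N]eq_bigr => e _ do rewrite muln1; rewrite leq_addr.
Qed.

Lemma digit_weight_lt D m : (mdeg m < D)%N ->
  (wdeg (digit_weight D) m < D ^ (n * n))%N.
Proof. by move=> mD; rewrite digit_weightE digits_lt // => t; apply: digit_lt. Qed.

Lemma digit_weight_inj D m m' : (mdeg m < D)%N -> (mdeg m' < D)%N ->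
  wdeg (digit_weight D) m = wdeg (digit_weight D) m' -> m = m'.
Proof.
move=> mD m'D; rewrite !digit_weightE => /digits_inj h.
apply/mnmP => i; rewrite -(enum_valK i); set e := enum_val i.
have := h (fun t => @digit_lt D m t mD) (fun t => @digit_lt D m' t m'D) _ (edge_code_lt e).
rewrite /digit !(big_pred1 e) // => e' /=;
  by apply/eqP/eqP => [/edge_code_inj|->].
Qed.

End Weights.

(** * Passage to skew-symmetric matrices *)

Section SkewRealization.

Context {n : nat} {K : fieldType}.

(** The linear part gives an equality. Among the powers of [D], the exponent [i' * n + j'] is
    strictly the largest of those involved, and [D] is at least two. *)
Lemma monge_digits (H G D : nat) : (n <= G)%N -> (1 < D)%N ->
  monge n (fun i j => (H * (G + j - i) + D ^ (i * n + j))%N%:Z).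
Proof.
move=> nG D1 i i' j j' ii' i'j jj' j'n; rewrite -!PoszD lez_nat.
have e : (H * (G + j' - i) + H * (G + j - i') =
          H * (G + j - i) + H * (G + j' - i'))%N.
  by rewrite -!mulnDr; congr (_ * _)%N; lia.
have h : (D ^ (i * n + j') + D ^ (i' * n + j) <= D ^ (i' * n + j'))%N.
  apply: leq_trans (_ : 2 * D ^ (i' * n + j').-1 <= _)%N.
    by rewrite mul2n -addnn; apply: leq_add; rewrite leq_exp2l //; nia.
  have {2}-> : (i' * n + j' = (i' * n + j').-1.+1)%N by lia.
  by rewrite expnS leq_mul2r D1 orbT.
lia.
Qed.

(* The upper triangle of the rank [k] matrix of [realization] is the leading part
   of a skew-symmetric matrix of rank [2 k], after rescaling row [i] by
   [t ^ (L (G - i))] and column [j] by [t ^ (L j)] with [L] large. *)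
Lemma skew_realize (k G E B c : nat) (F : rel nat) (v : nat -> nat -> nat)
    (P Q : nat -> nat -> {poly K}) : (n <= G)%N ->
    fits k n F (fun i j => (v i j)%:Z) E B c P Q ->
  exists (L : nat) (a b : 'I_n -> nat -> {poly K}),
    forall e : edge n,
    let Y := \sum_(l < k) (a (val e).1 l * b (val e).2 l
                           - a (val e).2 l * b (val e).1 l) in
    let d := (L * (G + (val e).2 - (val e).1) + c
              + B * v (val e).1 (val e).2)%N in
    (size Y <= (d + E).+1)%N /\ (F (val e).1 (val e).2 -> (d < size Y)%N).
Proof.
move=> nG fit; pose X i j := \sum_(l < k) P i l * Q j l.
pose L := (\sum_(i < n) \sum_(j < n) size (X i j)).+1.
have ltL (i j : 'I_n) : (size (X i j) < L)%N.
  rewrite ltnS (bigD1 i) //= (bigD1 j) //= -addnA; exact: leq_addr.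
pose a (i : 'I_n) l := 'X^(L * (G - i)) * P i l.
pose b (j : 'I_n) l := 'X^(L * j) * Q j l.
exists L, a, b => e; have ij := edge_lt e.
set i := (val e).1 in ij *; set j := (val e).2 in ij *.
have jn := ltn_ord j; move=> Y d.
have YE : Y = 'X^(L * (G + j - i)) * X i j - 'X^(L * (G + i - j)) * X j i.
  rewrite /Y sumrB /X !mulr_sumr; congr (_ - _); apply: eq_bigr => l _.
    rewrite /a /b mulrACA -exprD -mulnDr; congr ('X^(_ * _) * _); lia.
  rewrite /a /b mulrACA -exprD -mulnDr; congr ('X^(_ * _) * _); lia.
(* [L] exceeds every entry size, so the transposed entry cannot disturb the leading term. *)
have size2 : (size ('X^(L * (G + i - j)) * X j i)%R < L * (G + j - i))%N.
  apply: leq_ltn_trans (size_polyMleq _ _) _; rewrite size_polyXn /=.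
  apply: leq_trans (_ : L * (G + i - j) + L <= _)%N.
    by rewrite ltn_add2l ltL.
  rewrite -mulnSr leq_mul2l; apply/orP; right; lia.
have ijn : (i < j < n)%N by rewrite ij.
have [[nF X0]|[u [e' [d' [hX dE le_e hu hF]]]]] := fit i j ijn.
  rewrite (negPf nF); split=> //.
  rewrite YE /X X0 mulr0 sub0r size_polyN; apply: leq_trans (ltnW size2) _.
  rewrite /d; lia.
have hX' := monic_degM (monic_degXn K (L * (G + j - i))) hX.
have [|_ szY] := @monic_degDl K _ (- ('X^(L * (G + i - j)) * X j i)) _ hX'.
  rewrite size_polyN; apply: leq_trans size2 _; lia.
rewrite YE /X szY; split.
  by rewrite ltnS /d; nia.
move=> /hF; rewrite ltnS /d => vu; have uv : u = v i j by lia.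
rewrite uv in dE; lia.
Qed.

End SkewRealization.

(** * Independence modulo the Pfaffian ideal *)

Section Independence.

Context {n : nat} {K : fieldType}.

Lemma size_prod_edges_le (Y : edge n -> {poly K}) (d : edge n -> nat)
    (m : edge_monom n) : (forall e, size (Y e) <= (d e).+1)%N ->
  (size (\prod_e Y e ^+ m (enum_rank e))%R <= (wdeg d m).+1)%N.
Proof.
move=> hY; rewrite /wdeg; elim/big_ind2: _ => [|x p y q hx hy|e _].
- by rewrite size_poly1.
- by apply: leq_trans (size_polyMleq _ _) _; lia.
apply: leq_trans (size_poly_exp_leq _ _) _; rewrite ltnS mulnC leq_mul //.
by have := hY e; lia.
Qed.

Lemma size_prod_edges_gt (Y : edge n -> {poly K}) (d : edge n -> nat)
    (m : edge_monom n) : (forall e, e \in msupport m -> d e < size (Y e))%N ->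
  (wdeg d m < size (\prod_e Y e ^+ m (enum_rank e))%R)%N.
Proof.
move=> hY; rewrite /wdeg; elim/big_ind2: _ => [|x p y q hx hy|e _].
- by rewrite size_poly1.
- have x0 : x != 0 by rewrite -size_poly_gt0 (leq_ltn_trans (leq0n p)).
  have y0 : y != 0 by rewrite -size_poly_gt0 (leq_ltn_trans (leq0n q)).
  rewrite size_mul //; case: (size x) hx => // sx hx; case: (size y) hy => // sy hy.
  by rewrite addnS addSn ltnS leq_add.
have [->|m0] := posnP (m (enum_rank e)); first by rewrite expr0 size_poly1.
have lt : (d e < size (Y e))%N by apply: hY; rewrite inE.
have Y0 : Y e ^+ m (enum_rank e) != 0.
  by rewrite expf_neq0 // -size_poly_gt0 (leq_ltn_trans (leq0n _) lt).
rewrite -[X in (_ < X)%N]prednK ?size_poly_gt0 // size_exp ltnS mulnC leq_mul //.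
by case: (size (Y e)) lt.
Qed.

(** On a skew-symmetric matrix adapted to the leading monomial [m0], the value of [m0] has larger
    degree than those of the other monomials, yet all terms add up to zero. *)
Lemma standard_independent k (f : edge_poly K n) : pfaffian_ideal k f ->
  (forall m, m \in msupp f -> msupport m \in Ass k) -> f = 0.
Proof.
move=> fI stdf; apply/eqP; apply/negPn/negP => f0.
(* These constants make the weight [ve] compare monomials of [f] first by total degree, then by
   [om], and finally by their digits. *)
pose D := (msize f).+2; pose G := (n * D).+1; pose H := (D ^ (n * n))%N.
have degD m : m \in msupp f -> (mdeg m < D)%N.
  by move=> /msize_mdeg_lt h; rewrite /D; lia.
have nG : (n <= G)%N by rewrite /G /D; nia.
pose om (e : edge n) := (G + (val e).2 - (val e).1)%N.
pose v i j := (H * (G + j - i) + D ^ (i * n + j))%N.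
pose ve (e : edge n) := v (val e).1 (val e).2.
have wveE m : wdeg ve m = (H * wdeg om m + wdeg (digit_weight D) m)%N.
  by rewrite -wdegZ -wdegD.
have [m0 m0f m0max] : exists2 x, x \in msupp f &
    forall y, y \in msupp f -> (wdeg ve y <= wdeg ve x)%N.
  by apply: seq_argmax; rewrite msupp_eq0.
(* The degrees of the realization also contain multiples of [om] and of the total degree, with
   factors [L] and [c0] that are not controlled; hence [m0] has to be maximal for these two as
   well. *)
have om_le m : m \in msupp f -> (wdeg om m <= wdeg om m0)%N.
  move=> mf; have := m0max m mf; rewrite !wveE leqNgt => le.
  rewrite leqNgt; apply: contraNN le => lt.
  have := digit_weight_lt (degD _ m0f); rewrite -/H => ltH.
  apply: leq_trans (_ : H * (wdeg om m0).+1 <= _)%N.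
    by rewrite mulnSr ltn_add2l.
  by apply: leq_trans (leq_addr _ _); rewrite leq_mul2l lt orbT.
have deg_le m : m \in msupp f -> (mdeg m <= mdeg m0)%N.
  move=> mf; have := om_le m mf; rewrite leqNgt => le.
  rewrite leqNgt; apply: contraNN le => lt.
  apply: leq_trans (_ : wdeg (fun=> G) m <= _)%N; last first.
    by apply: leq_wdeg => e; rewrite /om; have := edge_lt e; lia.
  rewrite mdeg_scale; apply: leq_trans (_ : G * (mdeg m0).+1 <= _)%N; last first.
    by rewrite leq_mul2l lt orbT.
  apply: leq_ltn_trans (_ : wdeg (fun=> G + n)%N m0 < _)%N.
    by apply: leq_wdeg => e; rewrite /om; have := ltn_ord (val e).2; lia.
  by rewrite mdeg_scale mulnDl mulnSr ltn_add2l ltnS leq_mul2l ltnW ?orbT ?degD.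
have ve_lt m : m \in msupp f -> m != m0 -> (wdeg ve m < wdeg ve m0)%N.
  move=> mf ne; have := m0max m mf; rewrite leq_eqVlt => /orP[/eqP eq|//].
  case/negP: ne; apply/eqP/(@digit_weight_inj n D); rewrite ?degD //.
  have := congr1 (fun x => x %% H)%N eq; rewrite !wveE !(mulnC H) !modnMDl.
  by rewrite !modn_small // digit_weight_lt ?degD.
pose F := support_rel (msupport m0).
have [E hE] := realization K (@support_rel_lt n (msupport m0))
  (monge_digits H nG (isT : 1 < D)%N) (Ass_crossing_free (stdf _ m0f)).
(* The perturbations in a monomial of [f] add up to at most [E * D], less than one unit [B] of
   weight. *)
pose B := (E * D + E).+1; have [|c0 hc0] := hE B; first by rewrite /B; lia.
have [P [Q fit]] := hc0 c0 (leqnn _).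
have [L [a [b hY]]] := skew_realize nG fit.
pose Y (e : edge n) := \sum_(l < k) (a (val e).1 l * b (val e).2 l
                           - a (val e).2 l * b (val e).1 l).
pose d (e : edge n) := (L * om e + c0 + B * ve e)%N.
have wdE m : wdeg d m = (L * wdeg om m + c0 * mdeg m + B * wdeg ve m)%N.
  by rewrite -mdeg_scale -!wdegZ -!wdegD.
have Y_le e : (size (Y e) <= (d e + E).+1)%N by have [] := hY e.
have Y_gt e : e \in msupport m0 -> (d e < size (Y e))%N.
  by move=> em; have [_] := hY e; apply; rewrite support_relE.
pose T m := (f@_m)%:P * mmap1 (fun i => Y (enum_val i)) m.
have T0 : (wdeg d m0 < size (T m0))%N.
  rewrite /T size_Cmul -?mcoeff_msupp // prod_edges.
  exact: size_prod_edges_gt.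
have Tlt m : m \in msupp f -> m != m0 -> (size (T m) <= wdeg d m0)%N.
  move=> mf ne; rewrite /T size_Cmul -?mcoeff_msupp // prod_edges.
  apply: leq_trans (@size_prod_edges_le Y (fun e => d e + E)%N m Y_le) _.
  rewrite (wdegD d (fun=> E)) mdeg_scale !wdE.
  have := om_le m mf; have := deg_le m mf; have := ve_lt m mf ne.
  have := degD m mf; move=> h1 h2 h3 h4; have : (E * mdeg m < B)%N.
    by rewrite /B ltnS; apply: leq_trans (leq_addr _ _); rewrite leq_mul2l ltnW ?orbT.
  have : (B * (wdeg ve m).+1 <= B * wdeg ve m0)%N by rewrite leq_mul2l h2 orbT.
  have : (L * wdeg om m <= L * wdeg om m0)%N by rewrite leq_mul2l h4 orbT.
  have : (c0 * mdeg m <= c0 * mdeg m0)%N by rewrite leq_mul2l h3 orbT.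
  rewrite mulnSr; lia.
have f_eval : \sum_(m <- msupp f) T m = 0.
  apply: (@mmap_pfaffian_ideal n K {poly K} (@polyC K) Y k f) fI => U cU.
  by apply: matching_sum_low_rank_dom; rewrite cU; lia.
have : (size (T m0) <= wdeg d m0)%N; last by rewrite leqNgt T0.
move: f_eval; rewrite (bigD1_seq m0) ?msupp_uniq //= => /eqP.
rewrite addr_eq0 => /eqP ->; rewrite size_polyN big_seq_cond.
by apply: (leq_trans (size_sum _ _ _)); apply/bigmax_leqP_seq => m _ /andP[]; exact: Tlt.
Qed.

End Independence.

(** * Crossing matchings and fp-positivity *)

Section CrossingMatchings.

Context {n : nat}.
Implicit Types (e f : edge n) (E C : {set edge n}) (U : {set 'I_n}).

Definition rank_in U (u : nat) : nat := (\sum_(w in U) (w < u))%N.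

Lemma rank_in_mono U (u w : 'I_n) : u \in U -> (u < w)%N ->
  (rank_in U u < rank_in U w)%N.
Proof.
move=> uU uw; rewrite /rank_in (bigD1 u) //= [X in (_ < X)%N](bigD1 u) //=.
rewrite ltnn uw add0n add1n ltnS; apply: leq_sum => x _.
by case: (ltnP x u) => // xu; rewrite (ltn_trans xu uw).
Qed.

Lemma rank_in_inj U : {in U &, forall u w : 'I_n, rank_in U u = rank_in U w -> u = w}.
Proof.
move=> u w uU wU eq; have [lt|lt|/ord_inj //] := ltngtP u w.
  by have := rank_in_mono uU lt; rewrite eq ltnn.
by have := rank_in_mono wU lt; rewrite eq ltnn.
Qed.

Lemma rank_in_lt U (u : 'I_n) : u \in U -> (rank_in U u < #|U|)%N.
Proof.
move=> uU; rewrite /rank_in -sum1_card (bigD1 u) //= [X in (_ < X)%N](bigD1 u) //=.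
by rewrite ltnn add0n add1n ltnS; apply: leq_sum => x _; case: (_ < _)%N.
Qed.

(** Every edge of [C] contributes one to the difference of ranks: an edge crossing [e] has exactly
    one end between those of [e], and [e] contributes its own lower end. *)
Lemma rank_in_crossing m U C e : perfect_matching U C -> is_crossing m C ->
  e \in C -> rank_in U (val e).2 = (rank_in U (val e).1 + m)%N.
Proof.
move=> pm /is_crossingP[<- cC] eC.
rewrite /rank_in !(matching_sum_nat (fun w => (w < _)%N : nat) pm) -sum1_card.
rewrite -big_split /=; apply: eq_bigr => f fC.
have [->|ef] := eqVneq f e; first by rewrite !ltnn (edge_lt e) ltnNge ltnW ?edge_lt.
have := cC e f eC fC; rewrite eq_sym ef => /(_ isT); rewrite crossE.
have le := edge_lt e; have lf := edge_lt f.
case/orP => /and3P[h1 h2 h3].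
  rewrite h2 (ltnNge _ (val e).2) (ltnW h3) (ltnNge _ (val e).1) (ltnW h1).
  by rewrite ltnNge (ltnW (ltn_trans h1 lf)).
rewrite (ltn_trans h1 le) h3 h1 (ltnNge _ (val e).1) (ltnW h2) //.
Qed.

(** The edge of [C'] at the lower end of [e] has it as lower end too, since otherwise the upper end
    of [e] would have rank at least [2 k + 2]. The upper ends then have equal rank. *)
Lemma crossing_matching_sub k U C C' : #|U| = (2 * k + 2)%N ->
    perfect_matching U C -> is_crossing k.+1 C ->
    perfect_matching U C' -> is_crossing k.+1 C' ->
  C \subset C'.
Proof.
move=> cU pm crC pm' crC'; apply/subsetP => e eC.
have [h1 _ _] := perfect_matchingP _ _ pm.
have [h1' h2' _] := perfect_matchingP _ _ pm'.
have e1U : (val e).1 \in U by rewrite (subsetP (h1 e eC)) // mem_ends eqxx.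
have e2U : (val e).2 \in U by rewrite (subsetP (h1 e eC)) // mem_ends eqxx orbT.
have re := rank_in_crossing pm crC eC; have := rank_in_lt e2U.
rewrite re cU => lt; have [f fC'] := h2' _ e1U.
have rf := rank_in_crossing pm' crC' fC'; rewrite mem_ends => /orP[|]/eqP ef.
  suff -> : e = f by [].
  have f2U : (val f).2 \in U by rewrite (subsetP (h1' f fC')) // mem_ends eqxx orbT.
  by apply: edge_eqP => //; apply: (rank_in_inj e2U f2U); rewrite re rf ef.
by rewrite ef rf in lt; clear -lt; exfalso; lia.
Qed.

Lemma crossing_matching_uniq k U C C' : #|U| = (2 * k + 2)%N ->
    perfect_matching U C -> is_crossing k.+1 C ->
    perfect_matching U C' -> is_crossing k.+1 C' -> C = C'.
Proof.
move=> cU pm crC pm' crC'; apply/eqP.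
by rewrite eqEsubset !(@crossing_matching_sub k U).
Qed.

Lemma cross_disjoint e f u : cross e f -> u \in ends e -> u \notin ends f.
Proof.
rewrite crossE !mem_ends -!val_eqE /=; have := edge_lt e; have := edge_lt f.
by case: (val e) (val f) => a b [c d] /=; lia.
Qed.

Lemma crossing_matching m C : is_crossing m C ->
  perfect_matching (\bigcup_(e in C) ends e) C.
Proof.
move=> /is_crossingP[_ cC]; apply/perfect_matchingP; split.
- by move=> e eC; apply: (bigcup_max e).
- by move=> u /bigcupP[e eC ue]; exists e.
move=> e f u eC fC ue uf; apply/eqP; apply/negPn/negP => /(cC e f eC fC).
by move=> /cross_disjoint/(_ ue); rewrite uf.
Qed.

End CrossingMatchings.

(** * Maximal matchings for fp-positive weights *)

Section FpPositive.

Context {n : nat}.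
Implicit Types (e f : edge n) (E C : {set edge n}) (U : {set 'I_n}).

Lemma card_ends e : #|ends e| = 2%N.
Proof.
by rewrite cards2 -val_eqE /= neq_ltn edge_lt.
Qed.

Lemma matching_exists m U : #|U| = (2 * m)%N -> exists E, perfect_matching U E.
Proof.
elim: m U => [|m IH] U cU.
  exists set0; move/eqP: cU; rewrite muln0 cards_eq0 => /eqP ->.
  by apply/perfect_matchingP; split=> [e|u|e f u]; rewrite inE.
have [e eU] : exists e, ends e \subset U.
  have /card_gt1P[i [j [iU jU ij]]] : (1 < #|U|)%N by rewrite cU; lia.
  have [lt|lt|/ord_inj eq] := ltngtP i j; last by rewrite eq eqxx in ij.
    by exists (mkedge lt); apply/subsetP => u; rewrite mem_ends => /orP[|]/eqP ->.
  by exists (mkedge lt); apply/subsetP => u; rewrite mem_ends => /orP[|]/eqP ->.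
have [|E pm] := IH (U :\: ends e).
  by have := cardsID (ends e) U; rewrite (setIidPr eU) card_ends cU; lia.
by exists (e |: E); have [] := matching_add eU pm.
Qed.

(** The sums are taken in an arbitrary [M] because the exchange is applied both to real weights and
    to the potential below. *)
Lemma matching_exchange U E e f e' f' : perfect_matching U E ->
    e \in E -> f \in E -> e != f ->
    [disjoint ends e' & ends f'] ->
    ends e :|: ends f = ends e' :|: ends f' ->
  exists E', perfect_matching U E' /\
    forall (M : nmodType) (w : edge n -> M),
    exists r : M, \sum_(x in E) w x = w e + w f + r /\
                  \sum_(x in E') w x = w e' + w f' + r.
Proof.
move=> pm eE fE ef dis uni.
have fE' : f \in E :\ e by rewrite !inE eq_sym ef.
have pm2 := matching_del fE' (matching_del eE pm).
rewrite [U :\: _ :\: _]setDDl uni -setDDl in pm2.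
have [h1 _ _] := perfect_matchingP _ _ pm.
have sub : ends e' :|: ends f' \subset U.
  by rewrite -uni subUset (h1 e eE) (h1 f fE).
move: sub; rewrite subUset => /andP[e'U f'U].
have f'sub : ends f' \subset U :\: ends e'.
  by rewrite subsetD f'U disjoint_sym.
have [n2 pm3] := matching_add f'sub pm2.
have [n1 pm4] := matching_add e'U pm3.
exists (e' |: (f' |: E :\ e :\ f)); split=> // M w.
exists (\sum_(x in E :\ e :\ f) w x); split.
  by rewrite (big_setD1 e) //= (big_setD1 f) //= addrA.
by rewrite !big_setU1 //= addrA.
Qed.

(** A strictly concave function of the edge length, for which the fp-positivity inequalities are
    strict; it ensures that exchanges terminate. *)
Definition chord_potential e : nat :=
  (((val e).2 - (val e).1) * (n - ((val e).2 - (val e).1)))%N.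

Lemma chord_potential_lt (a a' b b' m : nat) (p := fun d : nat => (d * (m - d))%N) :
    (a < a')%N -> (a' < b)%N -> (b < b')%N -> (b' < m)%N ->
  (p (a' - a) + p (b' - b) < p (b - a) + p (b' - a'))%N /\
  (p (b' - a) + p (b - a') < p (b - a) + p (b' - a'))%N.
Proof.
(* The gaps between the points become variables, which removes truncated subtraction. *)
rewrite {}/p => /subnK <-; move: (a' - a.+1)%N => x /subnK <-; move: (b - _)%N => y.
move=> /subnK <-; move: (b' - _)%N => z /subnK <-; move: (m - _)%N => t.
have -> : (x + a.+1 - a = x.+1)%N by lia.
have -> : (z + (y + (x + a.+1).+1).+1 - (y + (x + a.+1).+1) = z.+1)%N by lia.
have -> : (y + (x + a.+1).+1 - a = x + y + 2)%N by lia.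
have -> : (z + (y + (x + a.+1).+1).+1 - (x + a.+1) = y + z + 2)%N by lia.
have -> : (z + (y + (x + a.+1).+1).+1 - a = x + y + z + 3)%N by lia.
have -> : (y + (x + a.+1).+1 - (x + a.+1) = y.+1)%N by lia.
set N := (t + _)%N.
have n1 : (N - x.+1 = a + y + z + t + 3)%N by rewrite /N; lia.
have n2 : (N - z.+1 = a + x + y + t + 3)%N by rewrite /N; lia.
have n3 : (N - (x + y + 2) = a + z + t + 2)%N by rewrite /N; lia.
have n4 : (N - (y + z + 2) = a + x + t + 2)%N by rewrite /N; lia.
have n5 : (N - (x + y + z + 3) = a + t + 1)%N by rewrite /N; lia.
have n6 : (N - y.+1 = a + x + z + t + 3)%N by rewrite /N; lia.
by rewrite n1 n2 n3 n4 n5 n6; split; nia.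
Qed.

(** Among the three matchings of the four ends of [e] and [f], fp-positivity favours the crossing
    one, which therefore replaces [e] and [f]. *)
Lemma uncross (R : realType) (v : {ffun edge n -> R}) U E e f :
    fp_positive v -> perfect_matching U E -> e \in E -> f \in E -> e != f ->
    ~~ cross e f ->
  exists2 E', perfect_matching U E' & (set_weight v E <= set_weight v E') /\
    (\sum_(x in E) chord_potential x < \sum_(x in E') chord_potential x)%N.
Proof.
move=> fp pm eE fE ef ncr.
have ne u : u \in ends e -> u \notin ends f.
  have [_ _ h3] := perfect_matchingP _ _ pm.
  by move=> ue; apply/negP => uf; rewrite (h3 e f u) ?eqxx in ef.
wlog lt1 : e f eE fE ef ncr ne / ((val e).1 < (val f).1)%N.
  move=> W; have [lt|lt|/ord_inj eq] := ltngtP (val e).1 (val f).1.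
  - exact: W lt.
  - apply: (W f e) => //; [by rewrite eq_sym|by rewrite cross_sym|].
    by move=> u uf; apply/negP => /ne; rewrite uf.
  by have := ne (val e).1; rewrite !mem_ends eq !eqxx => /(_ isT).
have le := edge_lt e; have lf := edge_lt f.
have [a [a' [b [b' [laa' la'b lbb' pos]]]]] : exists (a a' b b' : 'I_n),
    [/\ (a < a')%N, (a' < b)%N, (b < b')%N &
     (val e = (a, a') /\ val f = (b, b')) \/ (val e = (a, b') /\ val f = (a', b))].
  have d : (val e).2 != (val f).1 :> nat.
    by apply/eqP => /ord_inj h; have := ne (val e).2; rewrite !mem_ends h !eqxx orbT => /(_ isT).
  have d' : (val e).2 != (val f).2 :> nat.
    by apply/eqP => /ord_inj h; have := ne (val e).2; rewrite !mem_ends h !eqxx !orbT => /(_ isT).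
  have [lt|ge] := ltnP (val e).2 (val f).1.
    exists (val e).1, (val e).2, (val f).1, (val f).2; split=> //; left.
    by rewrite -!surjective_pairing.
  exists (val e).1, (val f).1, (val f).2, (val e).2; split=> //; last first.
    by right; rewrite -!surjective_pairing.
  rewrite ltn_neqAle eq_sym d' leqNgt; apply: contraNN ncr => h.
  by rewrite crossE lt1 h ltn_neqAle eq_sym d ge.
pose e' : edge n := mkedge (ltn_trans laa' la'b).
pose f' : edge n := mkedge (ltn_trans la'b lbb').
have dis : [disjoint ends e' & ends f'].
  apply/pred0P => u /=; apply/negbTE; rewrite negb_and -implybE.
  apply/implyP => ue; apply: cross_disjoint ue.
  by rewrite crossE /= laa' la'b lbb'.
have uni : ends e :|: ends f = ends e' :|: ends f'.
  apply/setP => u; rewrite !inE.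
  by case: pos => -[-> ->] /=; do 4!case: (u == _).
have [E' [pm' ex]] := matching_exchange pm eE fE ef dis uni.
exists E' => //; split.
  rewrite /set_weight; have [r [-> ->]] := ex R v; rewrite lerD2r.
  have := fp a a' b b' laa' la'b lbb'; rewrite ge_max => /andP[h1 h2].
  case: pos => -[ve vf].
    have -> : e = mkedge laa' by apply: val_inj.
    by have -> : f = mkedge lbb' by apply: val_inj.
  have -> : e = mkedge (ltn_trans (ltn_trans laa' la'b) lbb') by apply: val_inj.
  by have -> : f = mkedge la'b by apply: val_inj.
have [r [-> ->]] := ex nat chord_potential; rewrite ltn_add2r /chord_potential /=.
have [c1 c2] := chord_potential_lt laa' la'b lbb' (ltn_ord b').
by case: pos => -[-> ->].
Qed.

(** Among the matchings of maximal weight, one of maximal potential has only crossing pairs, as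
    [uncross] would improve it otherwise. *)
Lemma fp_positive_Grob (R : realType) k (v : {ffun edge n -> R}) :
  fp_positive v -> Grob k v.
Proof.
move=> fp U cU; have [|E0 pm0] := @matching_exists k.+1 U; first by rewrite cU; lia.
have [E1 pm1 max1] : exists2 E1, perfect_matching U E1 &
    forall E, perfect_matching U E -> set_weight v E <= set_weight v E1.
  by case: (arg_maxP (set_weight v) pm0) => E1 ? ?; exists E1.
pose P E := perfect_matching U E && (set_weight v E == set_weight v E1).
have P1 : P E1 by rewrite /P pm1 eqxx.
case: (@arg_maxnP _ E1 P (fun E => \sum_(x in E) chord_potential x)%N P1).
move=> E /andP[pm /eqP wE] maxE; exists E; split=> //.
  apply/is_crossingP; split.
    by have := card_matching pm; rewrite cU; lia.
  move=> e f eE fE ef; apply/negPn/negP => ncr.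
  have [E' pm' [w' lt]] := uncross fp pm eE fE ef ncr.
  have := maxE E'; rewrite /P pm' eq_le max1 // -wE w' => /(_ isT) h.
  by have := leq_ltn_trans h lt; rewrite ltnn.
by move=> E'; rewrite wE; apply: max1.
Qed.

End FpPositive.

(** * Initial ideals *)

Section IdealGen.

Context {K : fieldType} {N : nat}.
Implicit Types (f g : {mpoly K[N]}) (G : {mpoly K[N]} -> Prop).

Lemma ideal_gen_mem G f : G f -> ideal_gen G f.
Proof.
by move=> Gf; exists [:: (1, f)]; [move=> p; rewrite inE => /eqP ->|rewrite big_seq1 mul1r].
Qed.

Lemma ideal_gen0 G : ideal_gen G 0.
Proof. by exists [::] => //; rewrite big_nil. Qed.

Lemma ideal_genD G f g : ideal_gen G f -> ideal_gen G g -> ideal_gen G (f + g).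
Proof.
move=> [s hs ->] [t ht ->]; exists (s ++ t); last by rewrite big_cat.
by move=> p; rewrite mem_cat => /orP[/hs|/ht].
Qed.

Lemma ideal_genMl G f g : ideal_gen G g -> ideal_gen G (f * g).
Proof.
move=> [s hs ->]; exists [seq (f * p.1, p.2) | p <- s].
  by move=> _ /mapP[p /hs h ->].
by rewrite big_map mulr_sumr; apply: eq_bigr => p _; rewrite mulrA.
Qed.

Lemma ideal_genZ G c f : ideal_gen G f -> ideal_gen G (c *: f).
Proof. by rewrite -mul_mpolyC; exact: ideal_genMl. Qed.

Lemma ideal_genB G f g : ideal_gen G f -> ideal_gen G g -> ideal_gen G (f - g).
Proof. by move=> hf hg; rewrite -scaleN1r; apply/ideal_genD/ideal_genZ. Qed.

Lemma ideal_gen_sum G (I : finType) (P : pred I) (F : I -> {mpoly K[N]}) :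
  (forall i, P i -> ideal_gen G (F i)) -> ideal_gen G (\sum_(i | P i) F i).
Proof. by move=> h; elim/big_ind: _ => //; [exact: ideal_gen0|exact: ideal_genD]. Qed.

Lemma ideal_gen_sub G G' : (forall g, G g -> ideal_gen G' g) ->
  forall f, ideal_gen G f -> ideal_gen G' f.
Proof.
move=> h f [s hs ->]; rewrite big_seq; elim/big_rec: _ => [|p x ps hx].
  exact: ideal_gen0.
by apply: ideal_genD => //; apply/ideal_genMl/h/hs.
Qed.

End IdealGen.

(** * The Stanley-Reisner ideal *)

Section StanleyReisner.

Context {K : fieldType} {n : nat}.
Implicit Types (F S : {set edge n}) (m : edge_monom n) (f : edge_poly K n).

Lemma sqfree_monomE F e : sqfree_monom F (enum_rank e) = (e \in F).
Proof.
rewrite /sqfree_monom mnm_sumE (big_mkcond (mem F)) (bigD1 e) //= mnm1E eqxx.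
rewrite big1 => [|e' ne]; first by case: (e \in F).
by rewrite mnm1E (inj_eq enum_rank_inj) (negPf ne) if_same.
Qed.

Lemma msupport_sqfree F : msupport (sqfree_monom F) = F.
Proof. by apply/setP => e; rewrite inE sqfree_monomE; case: (e \in F). Qed.

Lemma sqfree_inj : injective (@sqfree_monom n).
Proof. by move=> F F' eq; rewrite -(msupport_sqfree F) eq msupport_sqfree. Qed.

Lemma sqfree_le F m : F \subset msupport m -> (sqfree_monom F <= m)%MM.
Proof.
move=> /subsetP sub; apply/mnm_lepP => i; rewrite -(enum_valK i) sqfree_monomE.
by case: (boolP (_ \in F)) => // /sub; rewrite inE.
Qed.

Lemma Ass_sub k S F : S \subset F -> F \in Ass k -> S \in Ass k.
Proof.
move=> SF; rewrite !inE; apply: contraNN => /existsP[C /andP[CS crC]].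
by apply/existsP; exists C; rewrite crC (subset_trans CS SF).
Qed.

(** A monomial ideal is tested term by term, and supersets of nonfaces are nonfaces. *)
Lemma stanley_reisnerP k f : stanley_reisner (Ass k) f <->
  (forall m, m \in msupp f -> msupport m \notin Ass k).
Proof.
split=> [[s hs ->] m hm|h].
  have /flattenP[t /mapP[p ps ->] mp] := msupp_sum_le hm.
  rewrite mem_filter /= in ps.
  have /allpairsP[[m1 m2] /= [_ m2p ->]] := msuppM_le mp.
  have [F FA e2] := hs p ps; move: m2p; rewrite e2 msuppX inE => /eqP ->.
  apply: contra FA; apply: Ass_sub; apply/subsetP => e eF.
  by rewrite inE mnmDE sqfree_monomE eF addn1.
exists [seq (f@_m *: 'X_[m - sqfree_monom (msupport m)],
            'X_[sqfree_monom (msupport m)]) | m <- msupp f].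
  by move=> _ /mapP[m /h mA ->] /=; exists (msupport m).
rewrite big_map [LHS]mpolyE; apply: eq_bigr => m _ /=.
by rewrite -scalerAl -mpolyXD submK // sqfree_le.
Qed.

(** If a monomial [m] of [f] is supported on a face, set the variables outside this face to zero.
    The ideal maps to zero in a domain, so the image of [f] is zero, but its coefficient at [m] is
    unchanged. *)
Lemma stanley_reisner_radical k : is_radical (stanley_reisner (K := K) (@Ass n k)).
Proof.
move=> f r /stanley_reisnerP h; apply/stanley_reisnerP => m mf.
apply/negP => mA; pose F := msupport m.
pose y (i : 'I_#|{: edge n}|) : edge_poly K n :=
  if enum_val i \in F then 'X_i else 0.
pose ev := mmap (@mpolyC #|{: edge n}| K) y.
have evX m' : mmap1 y m' = if msupport m' \subset F then 'X_[m'] else 0.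
  rewrite /mmap1; case: ifP => [/subsetP sub|/negbT /subsetPn[e em eF]].
    rewrite mpolyXE_id; apply: eq_bigr => i _; rewrite /y; case: ifP => // /negbT iF.
    suff -> : m' i = 0%N by rewrite !expr0.
    apply/eqP; rewrite -leqn0 leqNgt; apply: contraNN iF => lt.
    by apply: sub; rewrite inE enum_valK.
  rewrite (bigD1 (enum_rank e)) //= /y enum_rankK (negPf eF) expr0n.
  by move: em; rewrite inE; case: (m' _) => // a _; rewrite mul0r.
have ev0 g : (forall m', m' \in msupp g -> msupport m' \notin Ass k) -> ev g = 0.
  move=> hg; rewrite /ev /mmap big_seq big1 // => m' /hg m'A.
  rewrite evX; case: ifP => [sub|_]; last by rewrite mulr0.
  by case/negP: m'A; apply: Ass_sub sub mA.
have /eqP : ev f ^+ r = 0 by rewrite -[LHS]rmorphXn; exact: ev0.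
rewrite expf_eq0 => /andP[_ /eqP evf].
have : (ev f)@_m = f@_m.
  rewrite /ev /mmap raddf_sum (bigD1_seq m) ?msupp_uniq //= evX subxx.
  rewrite mcoeffCM mcoeffX eqxx mulr1 big1 ?addr0 // => m' ne.
  rewrite mcoeffCM evX; case: ifP => _; last by rewrite mcoeff0 mulr0.
  by rewrite mcoeffX (negPf ne) mulr0.
by rewrite evf mcoeff0 => /esym/eqP; apply/negP; rewrite -mcoeff_msupp.
Qed.

Lemma standard_stanley_reisner k F :
  standard_monomial (stanley_reisner (K := K) (Ass k)) (sqfree_monom F) <-> F \in Ass k.
Proof.
rewrite /standard_monomial; split=> [h|FA].
  apply/negPn/negP => FA; apply: h; apply/stanley_reisnerP => m.
  by rewrite msuppX inE => /eqP ->; rewrite msupport_sqfree.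
move/stanley_reisnerP/(_ (sqfree_monom F)).
by rewrite msuppX inE eqxx msupport_sqfree FA => /(_ isT).
Qed.

End StanleyReisner.

(** * Initial forms and reduction modulo the Pfaffians *)

Section InitialIdeal.

Context {R : realType} {K : fieldType} {n : nat}.
Implicit Types (v : {ffun edge n -> R}) (f g : edge_poly K n) (m : edge_monom n).
Implicit Types (E C : {set edge n}) (U : {set 'I_n}).

Lemma monom_weightD v m m' :
  monom_weight v (m + m') = monom_weight v m + monom_weight v m'.
Proof. by rewrite /monom_weight -big_split; apply: eq_bigr => e _; rewrite mnmDE mulrnDr. Qed.

Lemma monom_weight_sqfree v E : monom_weight v (sqfree_monom E) = set_weight v E.
Proof.
rewrite /monom_weight /set_weight [RHS]big_mkcond; apply: eq_bigr => e _.
by rewrite sqfree_monomE; case: (e \in E); rewrite ?mulr1n ?mulr0n.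
Qed.

Lemma mdeg_sqfree E : mdeg (sqfree_monom E) = #|E|.
Proof.
rewrite mdeg_sum -[RHS]sum1_card; apply: eq_bigr => e _; exact: mdeg1.
Qed.

Lemma pfaffianE U : @pfaffian K n U = \sum_(E | perfect_matching U E)
  (-1) ^+ cr E *: 'X_[sqfree_monom E].
Proof.
apply: eq_bigr => E _; rewrite -[RHS]mul_mpolyC rmorphXn rmorphN1; congr (_ * _).
by rewrite /sqfree_monom -mprodXE.
Qed.

Lemma mcoeff_pfaffian U E : perfect_matching U E ->
  (@pfaffian K n U)@_(sqfree_monom E) = (-1) ^+ cr E.
Proof.
move=> pm; rewrite pfaffianE raddf_sum (bigD1 E) //= mcoeffZ mcoeffX eqxx mulr1.
rewrite big1 ?addr0 // => E' /andP[_ ne].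
by rewrite mcoeffZ mcoeffX (inj_eq (@sqfree_inj n)) (negPf ne) mulr0.
Qed.

Lemma msupp_pfaffian U m : m \in msupp (@pfaffian K n U) ->
  exists2 E, perfect_matching U E & m = sqfree_monom E.
Proof.
rewrite pfaffianE => /msupp_sum_le/flattenP[t /mapP[E]].
rewrite mem_filter => /andP[pm _] -> /msuppZ_le; rewrite msuppX inE => /eqP ->.
by exists E.
Qed.

Lemma initial_form_monom v f m0 : m0 \in msupp f ->
    (forall m, m \in msupp f -> m != m0 -> monom_weight v m < monom_weight v m0) ->
  initial_form v f = f@_m0 *: 'X_[m0].
Proof.
move=> m0f lt; rewrite /initial_form big_seq_cond.
rewrite (eq_bigl (fun m => (m \in msupp f) && (m == m0))) => [|m].
  by rewrite -big_seq_cond -big_filter filter_pred1_uniq ?msupp_uniq // big_seq1.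
have [mf|//] := boolP (m \in msupp f); rewrite /=.
apply/allP/eqP => [h|-> m' m'f].
  apply/eqP/negPn/negP => ne; have := lt m mf ne.
  by rewrite ltNge h.
by have [->//|ne] := eqVneq m' m0; rewrite ltW // lt.
Qed.

Lemma msupp_initial_form v f m : m \in msupp (initial_form v f) ->
  m \in msupp f /\
  forall m', m' \in msupp f -> monom_weight v m' <= monom_weight v m.
Proof.
move=> /msupp_sum_le/flattenP[t /mapP[m1]].
rewrite mem_filter => /andP[/allP h m1f] -> /msuppZ_le; rewrite msuppX inE => /eqP ->.
by split.
Qed.

Section Reduction.

Variables (k : nat) (v : {ffun edge n -> R}).
Hypothesis crossing_max : forall C, is_crossing k.+1 C ->
  exists U, [/\ #|U| = (2 * k + 2)%N, perfect_matching U C &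
    forall E, perfect_matching U E -> E != C -> set_weight v E < set_weight v C].

Let I := @pfaffian_ideal K n k.

(** The term of [C] is the only one of maximal weight in the Pfaffian of [U]; its coefficient is a
    sign, removed by multiplying by the same sign. *)
Lemma initial_ideal_crossing C : is_crossing k.+1 C ->
  initial_ideal v I 'X_[sqfree_monom C].
Proof.
move=> /crossing_max[U [cU pm lt]].
have sgn_sq : (-1) ^+ cr C * (-1) ^+ cr C = 1 :> K by rewrite -expr2 sqrr_sign.
rewrite -[X in initial_ideal v I X]scale1r -sgn_sq -scalerA; apply: ideal_genZ.
apply: ideal_gen_mem; exists (@pfaffian K n U).
  by apply: ideal_gen_mem; exists U.
rewrite (@initial_form_monom _ _ (sqfree_monom C)) ?mcoeff_pfaffian //.
  by rewrite mcoeff_msupp mcoeff_pfaffian // signr_eq0.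
move=> m /msupp_pfaffian[E pmE ->]; rewrite (inj_eq (@sqfree_inj n)) => ne.
by rewrite !monom_weight_sqfree lt.
Qed.

Lemma stanley_reisner_initial f : stanley_reisner (Ass k) f -> initial_ideal v I f.
Proof.
apply: ideal_gen_sub => g [F FA ->]; move: FA; rewrite inE negbK.
case/existsP => C /andP[CF crC].
rewrite -[sqfree_monom F](@submK _ (sqfree_monom C)); last first.
  by apply: sqfree_le; rewrite msupport_sqfree.
by rewrite mpolyXD; apply: ideal_genMl; apply: initial_ideal_crossing.
Qed.

(** The last clause ensures that reduction preserves the coefficient of a standard monomial of
    maximal weight. *)
Definition normal_form_of m g : Prop :=
  [/\ I ('X_[m] - g),
    forall m', m' \in msupp g -> msupport m' \in Ass k &
    if msupport m \in Ass k then g = 'X_[m] else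
    forall m', m' \in msupp g -> monom_weight v m' < monom_weight v m].

(** A crossing [C] in [m] is replaced by the other matchings of its vertices, of the same size and
    smaller weight. Real weights are not well founded, but monomials of bounded degree are finite in
    number, so the induction is on how many of them have smaller weight. *)
Lemma normal_form m : exists g, normal_form_of m g.
Proof.
have [d] : exists d, mdeg m = d by exists (mdeg m).
pose lower (m : edge_monom n) := [set m' : 'X_{1..#|{: edge n}| < d.+1} |
  monom_weight v m' < monom_weight v m].
have [c] : exists c, (#|lower m| < c)%N by exists #|lower m|.+1.
elim: c m => [m|c IH m ltc degm]; first by rewrite ltn0.
rewrite /normal_form_of; have [mA|mA] := boolP (msupport m \in Ass k).
  exists 'X_[m]; split=> // [|m']; first by rewrite subrr; apply: ideal_gen0.
  by rewrite msuppX inE => /eqP ->.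
move: mA; rewrite inE negbK => /existsP[C /andP[CF crC]].
have [U [cU pmC lt]] := crossing_max crC.
pose m1 := (m - sqfree_monom C)%MM.
have mE : m = (m1 + sqfree_monom C)%MM by rewrite submK // sqfree_le.
have degE E : perfect_matching U E -> mdeg (m1 + sqfree_monom E) = mdeg m.
  move=> pm; rewrite mE !mdegD !mdeg_sqfree.
  by have := card_matching pm; have := card_matching pmC; lia.
have wE E : perfect_matching U E -> E != C ->
    monom_weight v (m1 + sqfree_monom E) < monom_weight v m.
  move=> pm ne; rewrite [in X in _ < X]mE !monom_weightD !monom_weight_sqfree.
  by rewrite ltrD2l lt.
have exg E : exists g, perfect_matching U E -> E != C ->
    [/\ I ('X_[m1 + sqfree_monom E] - g),
      forall m', m' \in msupp g -> msupport m' \in Ass k &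
      forall m', m' \in msupp g -> monom_weight v m' < monom_weight v m].
  case pm : (perfect_matching U E); last by exists 0.
  case: (eqVneq E C) => [->|ne]; first by exists 0.
  have [||g [h1 h2 h3]] := IH (m1 + sqfree_monom E)%MM.
  - have lt_bound : (mdeg (m1 + sqfree_monom E) < d.+1)%N.
      by rewrite degE // degm.
    rewrite ltnS in ltc; apply: leq_trans ltc; apply: proper_card; apply/properP; split.
      by apply/subsetP => m'; rewrite !inE => /lt_trans; apply; apply: wE.
    exists (BMultinom lt_bound); first by rewrite inE wE.
    by rewrite inE /= ltxx.
  - by rewrite degE.
  exists g => _ _; split=> // m' m'g.
  have := wE E pm ne; case: ifP h3 => [_ ge|_ h3].
    by move: m'g; rewrite ge msuppX inE => /eqP ->.
  exact: lt_trans (h3 m' m'g).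
have [g hg] := fin_all_exists exg.
exists (- \sum_(E | perfect_matching U E && (E != C)) ((-1) ^+ cr C * (-1) ^+ cr E) *: g E).
have supp m' : m' \in msupp (- \sum_(E | perfect_matching U E && (E != C))
     ((-1) ^+ cr C * (-1) ^+ cr E) *: g E) ->
    exists2 E, perfect_matching U E && (E != C) & m' \in msupp (g E).
  rewrite (perm_mem (msuppN _)) => /msupp_sum_le/flattenP[t /mapP[E]].
  by rewrite mem_filter => /andP[pm _] -> /msuppZ_le; exists E.
split.
- rewrite opprK.
  have -> : 'X_[m] + \sum_(E | perfect_matching U E && (E != C))
      ((-1) ^+ cr C * (-1) ^+ cr E) *: g E =
    ((-1) ^+ cr C *: 'X_[m1]) * @pfaffian K n U -
    \sum_(E | perfect_matching U E && (E != C))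
      ((-1) ^+ cr C * (-1) ^+ cr E) *: ('X_[m1 + sqfree_monom E] - g E).
    rewrite pfaffianE [X in _ = _ * X - _](bigD1 C) //= mulrDr -scalerAl -scalerAr -mpolyXD -mE.
    rewrite scalerA -expr2 sqrr_sign scale1r -addrA; congr (_ + _).
    rewrite mulr_sumr -sumrB; apply: eq_bigr => E _.
    by rewrite scalerBr opprB -scalerAl -scalerAr -mpolyXD scalerA addrC subrK.
  apply: ideal_genB.
    by apply: ideal_genMl; apply: ideal_gen_mem; exists U.
  apply: ideal_gen_sum => E /andP[pm ne]; apply: ideal_genZ.
  by have [] := hg E pm ne.
- by move=> m' /supp[E /andP[pm ne]]; have [_ h _] := hg E pm ne; apply: h.
by move=> m' /supp[E /andP[pm ne]]; have [_ _ h] := hg E pm ne; apply: h.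
Qed.

(** Replacing each monomial of [g] by its normal form gives an element of the ideal with standard
    support, hence zero. A standard monomial [m0] of maximal weight would keep its nonzero
    coefficient, since the nonstandard monomials reduce to weights strictly below its own. *)
Lemma initial_stanley_reisner f : initial_ideal v I f -> stanley_reisner (Ass k) f.
Proof.
apply: ideal_gen_sub => _ [g Ig ->]; apply/stanley_reisnerP => m0 m0g.
have {m0g}[m0g m0max] := msupp_initial_form m0g; apply/negP => m0A.
pose s := in_tuple (msupp g).
have [h hP] := fin_all_exists (fun i => normal_form (tnth s i)).
have gE : g = \sum_(i < size (msupp g)) g@_(tnth s i) *: 'X_[tnth s i].
  by rewrite {1}[g]mpolyE big_tnth.
pose r := \sum_(i < size (msupp g)) g@_(tnth s i) *: h i.
have r0 : r = 0.
  apply: (@standard_independent n K k).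
    rewrite -[r](subKr g); apply: ideal_genB => //.
    rewrite {1}gE /r -sumrB; apply: ideal_gen_sum => i _.
    by rewrite -scalerBr; apply: ideal_genZ; have [] := hP i.
  move=> m /msupp_sum_le/flattenP[t /mapP[i _ ->] /msuppZ_le].
  by have [_ hs _] := hP i; apply: hs.
have [i0 m0E] : exists i0, m0 = tnth s i0 by apply/tnthP.
have : r@_m0 = g@_m0.
  rewrite /r raddf_sum (bigD1 i0) //= -m0E mcoeffZ.
  have [_ _] := hP i0; rewrite -m0E m0A => ->; rewrite mcoeffX eqxx mulr1.
  rewrite big1 ?addr0 // => i ne; rewrite mcoeffZ; apply/eqP.
  rewrite mulf_eq0; apply/orP; right; rewrite mcoeff_eq0.
  have si : tnth s i \in msupp g by exact: mem_tnth.
  have [_ _] := hP i; case: ifP => [_ ->|_ hlt].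
    rewrite msuppX inE m0E; apply: contra ne => /eqP/esym e.
    by apply/eqP/(tuple_uniqP s (msupp_uniq g)).
  by apply/negP => /hlt; rewrite ltNge m0max.
by rewrite r0 mcoeff0 => /esym/eqP; apply/negP; rewrite -mcoeff_msupp.
Qed.

End Reduction.

End InitialIdeal.

(** * Generic weights and the theorem *)

Section Generic.

Context {R : realType} {n : nat}.

(** Normal vector of the hyperplane on which [E] and [E'] have the same weight. *)
Definition indicator_diff (E E' : {set edge n}) : {ffun edge n -> R} :=
  [ffun e => (e \in E)%:R - (e \in E')%:R].

Lemma indicator_diff_eq0 E E' : (indicator_diff E E' == 0) = (E == E').
Proof.
apply/eqP/eqP => [/ffunP h|->].
  apply/setP => e; have := h e; rewrite !ffunE => /eqP.
  by rewrite subr_eq0 eqr_nat; do 2!case: (_ \in _).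
by apply/ffunP => e; rewrite !ffunE subrr.
Qed.

Lemma indicator_diff_weight E E' (v : {ffun edge n -> R}) :
  \sum_(e : edge n) indicator_diff E E' e * v e = set_weight v E - set_weight v E'.
Proof.
rewrite /set_weight !(big_mkcond (fun e => e \in _)) -sumrB.
apply: eq_bigr => e _; rewrite ffunE mulrBl.
by do 2!case: (_ \in _); rewrite ?mul1r ?mul0r.
Qed.

(** On the vertex set of [C], the maximal matching provided by [Grob] is [C] by uniqueness;
    injectivity of the weight makes the maximum strict. *)
Lemma Grob_crossing_max k (v : {ffun edge n -> R}) (C : {set edge n}) :
    Grob k v -> injective (set_weight v) ->
    is_crossing k.+1 C ->
  exists U : {set 'I_n}, [/\ #|U| = (2 * k + 2)%N, perfect_matching U C &
    forall E : {set edge n}, perfect_matching U E -> E != C -> set_weight v E < set_weight v C].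
Proof.
move=> gr inj crC; have pm := crossing_matching crC.
have cU : #|\bigcup_(e in C) ends e| = (2 * k + 2)%N.
  by rewrite (card_matching pm); have [-> _] := is_crossingP _ _ crC; lia.
have [C' [pm' crC' maxC']] := gr _ cU.
have eqC := crossing_matching_uniq cU pm crC pm' crC'.
exists (\bigcup_(e in C) ends e); split=> // E pmE ne.
rewrite lt_neqAle eqC maxC' // andbT; apply: contra ne => /eqP.
by rewrite eqC => /inj ->.
Qed.

End Generic.

Theorem corollary2p13 (R : realType) (K : fieldType) (k n : nat)
    (k_ge1 : (1 <= k)%N) (n_ge : (2 * k + 2 <= n)%N) :
  (forall v : {ffun edge n -> R}, fp_positive v -> Grob k v) /\
  for_generic (fun v : {ffun edge n -> R} =>
    Grob k v ->
    let J := initial_ideal v (@pfaffian_ideal K n k) in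
    [/\ forall f : edge_poly K n, J f <-> stanley_reisner (Ass k) f,
        is_radical J,
        is_monomial_ideal J
      & forall F : {set edge n},
          standard_monomial J (sqfree_monom F) <-> F \in Ass k]).
Proof.
split; first by move=> v; exact: fp_positive_Grob.
(* Outside these finitely many hyperplanes, distinct sets of edges have distinct weights. *)
pose hs : seq {ffun edge n -> R} := [seq indicator_diff p.1 p.2
  | p <- enum {: {set edge n} * {set edge n}} & p.1 != p.2].
exists hs.
  apply/negP => /mapP[p]; rewrite mem_filter => /andP[ne _] /esym/eqP.
  by rewrite indicator_diff_eq0 (negPf ne).
move=> v gen gr J.
have inj : injective (set_weight v).
  move=> E E' eqw; apply/eqP/negPn/negP => ne.
  have /gen : indicator_diff E E' \in hs.
    by apply/mapP; exists (E, E') => //; rewrite mem_filter /= ne mem_enum inE.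
  by rewrite indicator_diff_weight eqw subrr eqxx.
have cmax C := @Grob_crossing_max R n k v C gr inj.
have JE f : J f <-> stanley_reisner (Ass k) f.
  split; first exact: initial_stanley_reisner.
  exact: stanley_reisner_initial.
split=> //.
- by move=> f m /JE/stanley_reisner_radical/JE.
- exists (fun m => exists2 F, F \notin Ass k & m = sqfree_monom F) => f.
  rewrite JE; split; apply: ideal_gen_sub => g.
    by case=> F FA ->; apply: ideal_gen_mem; exists (sqfree_monom F) => //; exists F.
  by case=> _ [F FA ->] ->; apply: ideal_gen_mem; exists F.
move=> F; rewrite -(standard_stanley_reisner (K := K)) /standard_monomial.
by split=> h /JE.
Qed.
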